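(* Let $n\ge1$ and let $a\ge 3$ be an odd integer with binary expansion $a=2^{i_1}+2^{i_2}+\cdots+2^{i_d}$, where $i_1>i_2>\cdots>i_d=0$ (so $d\ge2$). Then for every integer $\alpha$ with $$1\le\alpha\le 2an-(d-1)-\sum_{k=1}^{d}i_k,$$ the hypercube $Q_{2an}$ can be decomposed into $n2^{2an-\alpha}$ cycles, each of length $a\cdot2^{\alpha}$.
   Context: $Q_m$ is the $m$-dimensional hypercube: vertex set $\{0,1\}^m$, edges joining vertices that differ in exactly one component. A decomposition of a graph into cycles is a family of cycle subgraphs with pairwise disjoint edge sets whose union is the graph. *)

(* Defs.v *)
From mathcomp Require Import all_boot.
Set Implicit Arguments.
Unset Strict Implicit.
Unset Printing Implicit Defensive.

Section CycleDecomposition.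
Variables (T : finType) (e : rel T).
Implicit Types (c : seq T) (C : {set {set T}}) (D : {set {set {set T}}}).

(* Edges are unordered pairs; [e] is meant to be symmetric and irreflexive. *)
Definition edge_set : {set {set T}} :=
  [set [set xy.1; xy.2] | xy : T * T & e xy.1 xy.2].

Definition edges_along c : {set {set T}} :=
  [set [set x; next c x] | x in c].

(* A cycle subgraph has no isolated vertices, so it is identified with its    *)
(* edge set C, and its length is #|C|.  The bound 3 <= size c excludes a      *)
(* single edge traversed back and forth.                                      *)
Definition is_cycle_subgraph C : Prop :=
  exists c, [/\ 3 <= size c, uniq c, cycle e c & C = edges_along c].

(* [partition] also demands that the members of D be nonempty, which every    *)
(* cycle subgraph is; disjoint nonempty members are distinct, so #|D| is the  *)
(* number of cycles in the family.                                            *)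
Definition cycle_decomposition D : Prop :=
  partition D edge_set /\ forall C, C \in D -> is_cycle_subgraph C.

End CycleDecomposition.

Definition hypercube (m : nat) : rel {ffun 'I_m -> bool} :=
  fun x y => #|[set k | x k != y k]| == 1.

Lemma hypercube_sym m : symmetric (@hypercube m).
Proof.
by move=> x y; congr (_ == 1); apply: eq_card => k; rewrite !inE eq_sym.
Qed.

Lemma hypercube_irr m : irreflexive (@hypercube m).
Proof.
move=> x; rewrite /hypercube (_ : [set k | _] = set0) ?cards0 //.
by apply/setP=> k; rewrite !inE eqxx.
Qed.

(* Main.v *)
Require Import Defs.
From mathcomp Require Import all_boot.
From mathcomp Require Import ssralg zmodp zify.
Set Implicit Arguments.
Unset Strict Implicit.
Unset Printing Implicit Defensive.

(** The cube of dimension 2an is the a-th power of Q_2n, and Q_2n splits into n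
    Hamiltonian cycles of length 4^n ([cube_hamiltonian]).  Hence Q_2an is an
    edge-disjoint union of n spanning tori, each the product of a rings of
    length 4^n, and it suffices to cut the a-dimensional torus over a ring of
    length 2^q into cycles of length a 2^b ([torus_dec_odd]); the values of b
    that are too small for this torus are reached by splitting the coordinates
    of the cube in two halves ([cube_dec]).

    The torus is treated along the binary expansion of a, read from its last
    digit: a = 2^j a' + 1.  Let V be the torus with 2^j a' coordinates, already
    cut into cycles of length P 2^j a' with P a power of two.  Every vertex of
    V lies on 2^j a' of them, so by Hall's theorem each cycle can choose P of
    its vertices in such a way that every vertex is chosen exactly once
    ([even_selection]).  In the product of V with one more ring, a strand
    follows a cycle of V and, at each chosen vertex, moves by one step up or
    down the ring ([dec_weave_cycle]).  If the moves along a cycle of V add up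
    to an even number E, the two strands through a vertex reach its
    column at heights of different parity, so every strand is a genuine cycle; it closes up after a
    number of turns equal to the order of E modulo 2^q, and it has
    P (2^j a' + 1) = P a edges per turn.  The cycles of V come from the case of
    a', because the 2^j-th power of a ring splits into 2^j Hamiltonian cycles
    ([torus_dec_double]).  Each digit costs j + 1 in the exponent of the longest
    cycle; the relation [loss] records the total.

    The Hamiltonian decomposition of Q_2n is by induction.  If n is even,
    Q_2n is the square of Q_n, and the product of two Hamiltonian cycles is
    woven into two.  If n = 2m + 1, one factor of Q_2m x Q_(2m+2) has one
    Hamiltonian cycle more than the other, and once the union of two
    Hamiltonian cycles, multiplied by a third one, must be cut into three
    ([dec_triple]).  This is done with three permutations of the vertices that
    share out the edges; two of them have a single orbit and the third one has at
    most two.  Exchanging the sides of a square between two of these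
    permutations, which reverses a part of their orbits, merges the two orbits
    ([switch_dec]). *)

(** * Decompositions into cycles *)
Definition traverses (T : Type) (X : Type) (s : X -> X) (loc : X -> T) u v :=
  exists x, (loc x = u /\ loc (s x) = v) \/ (loc x = v /\ loc (s x) = u).

(** The orbits of [s] are the cycles, all of length l: [loc] sends a position on
    a cycle to a vertex, and the second condition says that no vertex is
    repeated before the cycle closes.  Every vertex is visited r times, as in
    a graph of degree 2r.  Edges are only asked to be covered: in a simple
    2r-regular graph counting then shows that they are covered once.  The
    relation [e] may list an edge in one direction only. *)
Definition decomposes (T : finType) (e : T -> T -> Prop) (r l : nat) : Prop :=
  exists (X : finType) (s : X -> X) (loc : X -> T),
    [/\ forall x, iter l s x = x,
        forall x i, loc (iter i s x) = loc x -> l %| i,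
        forall v, #|[set x | loc x == v]| = r
      & forall u v, e u v -> traverses s loc u v].

Lemma dec_sub (T : finType) (e e' : T -> T -> Prop) r l :
  (forall u v, e' u v -> e u v) -> decomposes e r l -> decomposes e' r l.
Proof.
move=> sub [X [s [loc [h1 h2 h3 h4]]]]; exists X, s, loc; split=> // u v /sub.
exact: h4.
Qed.

Lemma dec_sym (T : finType) (e : T -> T -> Prop) r l :
  decomposes e r l -> decomposes (fun u v => e u v \/ e v u) r l.
Proof.
move=> [X [s [loc [h1 h2 h3 h4]]]]; exists X, s, loc; split=> // u v [/h4 //|/h4].
by case=> x [] h; exists x; [right | left].
Qed.

Lemma dec0 (T : finType) l : decomposes (fun _ _ : T => False) 0 l.
Proof.
exists void, id, (fun x : void => match x with end); split=> [[]|[]|v|u v []].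
by apply: eq_card0; case.
Qed.

Lemma dec_union (T : finType) (e1 e2 : T -> T -> Prop) r1 r2 l :
  decomposes e1 r1 l -> decomposes e2 r2 l -> decomposes (fun u v => e1 u v \/ e2 u v) (r1 + r2) l.
Proof.
move=> [X1 [s1 [l1 [a1 b1 c1 d1]]]] [X2 [s2 [l2 [a2 b2 c2 d2]]]].
pose s (z : X1 + X2) : X1 + X2 :=
  match z with inl x => inl (s1 x) | inr x => inr (s2 x) end.
pose loc (z : X1 + X2) := match z with inl x => l1 x | inr x => l2 x end.
have itl i x : iter i s (inl x) = inl (iter i s1 x) by elim: i => //= i ->.
have itr i x : iter i s (inr x) = inr (iter i s2 x) by elim: i => //= i ->.
exists (X1 + X2)%type, s, loc; split.
- by case=> x; rewrite ?itl ?itr ?a1 ?a2.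
- by case=> x i; rewrite ?itl ?itr /=; [apply: b1 | apply: b2].
- move=> v; rewrite -(c1 v) -(c2 v) -!sum1_card big_sumType.
  by congr (_ + _); apply: eq_bigl => x; rewrite !inE.
- move=> u v [/d1|/d2] [x hx]; first by exists (inl x).
  by exists (inr x).
Qed.

Lemma dec_iso (T T' : finType) (e : T -> T -> Prop) (e' : T' -> T' -> Prop)
    (f : T' -> T) r l :
  bijective f -> (forall u v, e' u v -> e (f u) (f v)) ->
  decomposes e r l -> decomposes e' r l.
Proof.
move=> [g fK gK] sub [X [s [loc [h1 h2 h3 h4]]]].
exists X, s, (g \o loc); split=> //.
- by move=> x i /= /(can_inj gK); apply: h2.
- move=> v; rewrite -(h3 (f v)); apply: eq_card => x; rewrite !inE /=.
  by apply/eqP/eqP => [<-|->].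
- move=> u v /sub /h4 [x hx]; exists x => /=.
  by case: hx => -[-> ->]; rewrite !fK; [left | right].
Qed.

Definition cart (T1 T2 : Type) (e1 : T1 -> T1 -> Prop) (e2 : T2 -> T2 -> Prop)
    (u v : T1 * T2) : Prop :=
  (e1 u.1 v.1 /\ u.2 = v.2) \/ (u.1 = v.1 /\ e2 u.2 v.2).

Definition no_edge (T : Type) (_ _ : T) := False.

(** One copy of the decomposition in every layer: the layers share no edge and
    together span the product. *)
Lemma dec_layers (T1 T2 : finType) (e1 : T1 -> T1 -> Prop) r l :
  decomposes e1 r l -> decomposes (cart e1 (@no_edge T2)) r l.
Proof.
move=> [X [s [loc [h1 h2 h3 h4]]]].
pose s' (z : X * T2) := (s z.1, z.2); pose loc' (z : X * T2) := (loc z.1, z.2).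
have it i z : iter i s' z = (iter i s z.1, z.2) by elim: i => [|i /= ->]; case: z.
exists (X * T2)%type, s', loc'; split.
- by move=> [x y]; rewrite it h1.
- by move=> [x y] i; rewrite it => -[] /h2.
- move=> [v y]; rewrite -(h3 v) -[RHS](card_imset _ (f := fun x => (x, y))).
    apply: eq_card => -[x y']; rewrite !inE /=; apply/eqP/imsetP.
      by case=> <- <-; exists x; rewrite ?inE.
    by case=> x'; rewrite inE => /eqP <- [-> ->].
  by move=> x x' [].
- move=> [u y] [v y'] [[/= /h4 [x hx] <-]|[]//]; exists (x, y).
  by case: hx => -[<- <-]; [left | right].
Qed.

Lemma dec_cart (T1 T2 : finType) (e1 : T1 -> T1 -> Prop) (e2 : T2 -> T2 -> Prop)
    r1 r2 l :
  decomposes e1 r1 l -> decomposes e2 r2 l -> decomposes (cart e1 e2) (r1 + r2) l.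
Proof.
move=> d1 d2.
have d2' : decomposes (cart (@no_edge T1) e2) r2 l.
  apply: (dec_iso (f := fun z => (z.2, z.1))) (dec_layers T1 d2).
    by exists (fun z => (z.2, z.1)) => -[].
  by move=> [u1 u2] [v1 v2] [[[]]|[/= -> h]]; left.
apply: dec_sub (dec_union (dec_layers T2 d1) d2') => u v [h|h].
  by left; left.
by right; right.
Qed.

(** * Powers of a graph *)
Definition gpower (I : finType) (Y : finType) (e : Y -> Y -> Prop)
    (x y : {ffun I -> Y}) : Prop :=
  exists i, e (x i) (y i) /\ forall j, j != i -> x j = y j.

Lemma dec_pw_reindex (I J Y : finType) (e : Y -> Y -> Prop) r l :
  #|I| = #|J| -> decomposes (@gpower I Y e) r l -> decomposes (@gpower J Y e) r l.
Proof.
move=> eqIJ.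
have [f [g fK gK]] : exists f : I -> J, bijective f.
  exists (fun i => enum_val (cast_ord eqIJ (enum_rank i))).
  exists (fun j => enum_val (cast_ord (esym eqIJ) (enum_rank j))) => i.
    by rewrite enum_valK cast_ordK enum_rankK.
  by rewrite enum_valK cast_ordKV enum_rankK.
apply: (dec_iso (f := fun x : {ffun J -> Y} => [ffun i => x (f i)])).
  by exists (fun x : {ffun I -> Y} => [ffun j => x (g j)]) => x;
    apply/ffunP => i; rewrite !ffunE ?fK ?gK.
move=> u v [j [h1 h2]]; exists (g j); rewrite !ffunE gK; split=> // i ni.
rewrite !ffunE; apply: h2; apply: contraNneq ni => <-; by rewrite fK.
Qed.

Lemma dec_pw_sum (I J Y : finType) (e : Y -> Y -> Prop) r l :
  decomposes (cart (@gpower I Y e) (@gpower J Y e)) r l -> decomposes (@gpower (I + J)%type Y e) r l.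
Proof.
apply: (dec_iso (f := fun x : {ffun I + J -> Y} =>
  ([ffun i => x (inl i)], [ffun j => x (inr j)]))).
  exists (fun z : {ffun I -> Y} * {ffun J -> Y} =>
    [ffun k => match k with inl i => z.1 i | inr j => z.2 j end]).
    by move=> x; apply/ffunP => -[i|j]; rewrite !ffunE.
  by move=> [x y]; congr (_, _); apply/ffunP => i; rewrite !ffunE.
move=> u v [[k|k] [h1 h2]]; [left | right]; split=> /=.
- by exists k; split=> [|j nj]; rewrite !ffunE //; apply: h2.
- by apply/ffunP => j; rewrite !ffunE; apply: h2.
- by apply/ffunP => j; rewrite !ffunE; apply: h2.
- by exists k; split=> [|j nj]; rewrite !ffunE //; apply: h2.
Qed.

Lemma dec_pw_curry (I J Y : finType) (e : Y -> Y -> Prop) r l :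
  decomposes (@gpower I _ (@gpower J Y e)) r l -> decomposes (@gpower (I * J)%type Y e) r l.
Proof.
apply: (dec_iso (f := fun x : {ffun I * J -> Y} =>
  [ffun i => [ffun j => x (i, j)]])).
  exists (fun z : {ffun I -> {ffun J -> Y}} => [ffun k => z k.1 k.2]) => x.
    by apply/ffunP => -[i j]; rewrite !ffunE.
  by apply/ffunP => i; apply/ffunP => j; rewrite !ffunE.
move=> u v [[i j] [h1 h2]]; exists i; split.
  exists j; rewrite !ffunE; split=> // j' nj; rewrite !ffunE; apply: h2.
  by apply: contraNneq nj => -[->].
move=> i' ni; apply/ffunP => j'; rewrite !ffunE; apply: h2.
by apply: contraNneq ni => -[->].
Qed.

Lemma dec_pw1 (I Y : finType) (e : Y -> Y -> Prop) r l :
  #|I| = 1 -> decomposes e r l -> decomposes (@gpower I Y e) r l.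
Proof.
move=> I1 de; apply: (@dec_pw_reindex unit); first by rewrite card_unit.
apply: (dec_iso (f := fun x : {ffun unit -> Y} => x tt)) de.
  exists (fun y => [ffun _ : unit => y]) => [x|y]; last by rewrite ffunE.
  by apply/ffunP => -[]; rewrite ffunE.
by move=> u v [[] []].
Qed.

Lemma dec_pw_iso (I Y Y' : finType) (e : Y -> Y -> Prop) (e' : Y' -> Y' -> Prop)
    (f : Y' -> Y) r l :
  bijective f -> (forall u v, e' u v -> e (f u) (f v)) ->
  decomposes (@gpower I Y e) r l -> decomposes (@gpower I Y' e') r l.
Proof.
move=> [g fK gK] sub.
apply: (dec_iso (f := fun x : {ffun I -> Y'} => [ffun i => f (x i)])).
  by exists (fun x : {ffun I -> Y} => [ffun i => g (x i)]) => x;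
    apply/ffunP => i; rewrite !ffunE ?fK ?gK.
move=> u v [i [h1 h2]]; exists i; rewrite !ffunE; split; first exact: sub.
by move=> j nj; rewrite !ffunE h2.
Qed.

(** * Hamiltonian cycles *)
Definition hamiltonian (T : finType) (c : seq T) := uniq c && [forall x, x \in c].

Definition follows (T : finType) (c : seq T) : T -> T -> Prop :=
  fun u v => next c u = v.

Lemma next_nth_mod (T : eqType) (c : seq T) x0 i :
  uniq c -> i < size c -> next c (nth x0 c i) = nth x0 c (i.+1 %% size c).
Proof.
move=> uc lti; rewrite next_nth mem_nth //; case: c uc lti => // y p up lti.
rewrite index_uniq //; case: (ltnP i (size p)) => hi.
  by rewrite modn_small //=; apply: set_nth_default.
rewrite nth_default //.
have -> : i.+1 = size (y :: p) by apply/eqP; rewrite eqn_leq lti /= ltnS.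
by rewrite modnn.
Qed.

Section Hamiltonian.
Variables (T : finType) (c : seq T).
Hypothesis hc : hamiltonian c.

Lemma ham_uniq : uniq c. Proof. by case/andP: hc. Qed.
Lemma ham_mem x : x \in c. Proof. by case/andP: hc => _ /forallP. Qed.
Lemma ham_size : size c = #|T|.
Proof.
rewrite -(card_uniqP ham_uniq); apply: eq_card => x.
by rewrite ham_mem inE.
Qed.

Lemma iter_next_nth x0 i k : k < size c ->
  iter i (next c) (nth x0 c k) = nth x0 c ((k + i) %% size c).
Proof.
move=> ltk; elim: i => [|i IHi] /=; first by rewrite addn0 modn_small.
rewrite IHi next_nth_mod ?ham_uniq ?ltn_mod ?(leq_ltn_trans _ ltk) //.
by rewrite addnS -[in LHS]addn1 modnDml addn1.
Qed.

Lemma ham_dec : decomposes (follows c) 1 #|T|.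
Proof.
exists T, (next c), id; split.
- move=> x; have lx : index x c < size c by rewrite index_mem ham_mem.
  rewrite -{1}(nth_index x (ham_mem x)) iter_next_nth // -ham_size modnDr.
  by rewrite modn_small // nth_index ?ham_mem.
- move=> x i; have lx : index x c < size c by rewrite index_mem ham_mem.
  rewrite -{1}(nth_index x (ham_mem x)) iter_next_nth //= => h.
  have lm : (index x c + i) %% size c < size c.
    by rewrite ltn_mod (leq_ltn_trans _ lx).
  have := index_uniq x lm ham_uniq; rewrite h => e.
  have : index x c + i == index x c + 0 %[mod size c].
    by rewrite -e addn0 modn_small.
  by rewrite eqn_modDl mod0n -ham_size.
- move=> v; rewrite -[RHS](cards1 v); apply: eq_card => x.
  by rewrite !inE.
- by move=> u v <-; exists u; left.
Qed.

Lemma ham_iso (N : nat) (x0 : T) : #|T| = N ->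
  exists f : T -> 'I_N, [/\ bijective f,
    forall u v, follows c u v -> ordS (f u) = f v,
    forall u, nth x0 c (f u) = u & forall u, f u = index u c :> nat].
Proof.
move=> <-; have lx u : index u c < #|T| by rewrite -ham_size index_mem ham_mem.
exists (fun u => Ordinal (lx u)); split=> //.
- exists (fun i : 'I_#|T| => nth x0 c i) => [u|i] /=; first by rewrite nth_index ?ham_mem.
  by apply: val_inj; rewrite /= index_uniq ?ham_size ?ham_uniq.
- move=> u v <-; apply: val_inj => /=.
  rewrite -{2}(nth_index x0 (ham_mem u)) next_nth_mod ?ham_uniq ?index_mem ?ham_mem //.
  rewrite index_uniq ?ham_uniq ?ham_size // ltn_mod.
  by apply: leq_ltn_trans (lx u).
- by move=> u /=; rewrite nth_index ?ham_mem.
Qed.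

End Hamiltonian.

Lemma ham_ord N : 0 < N -> decomposes (fun u v : 'I_N => ordS u = v) 1 N.
Proof.
case: N => // N _.
have hc : hamiltonian (enum 'I_N.+1).
  by rewrite /hamiltonian enum_uniq; apply/forallP => x; rewrite mem_enum.
have := ham_dec hc; rewrite card_ord; apply: dec_sub => u v <-; rewrite /follows.
rewrite -{1}(nth_ord_enum u u) next_nth_mod ?enum_uniq // size_enum_ord //.
by apply: val_inj; rewrite /= nth_enum_ord // ltn_mod.
Qed.

Lemma ham_rev (T : finType) (c : seq T) : hamiltonian c -> hamiltonian (rev c).
Proof.
by case/andP=> h1 /forallP h2; rewrite /hamiltonian rev_uniq h1; apply/forallP => x; rewrite mem_rev.
Qed.

Lemma ham_rot (T : finType) (c : seq T) n : hamiltonian c -> hamiltonian (rot n c).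
Proof.
by case/andP=> h1 /forallP h2; rewrite /hamiltonian rot_uniq h1; apply/forallP => x; rewrite mem_rot.
Qed.

(** * Spanning cycle systems *)
Definition union_ham (T : finType) (cs : seq (seq T)) (u v : T) : Prop :=
  exists2 c, c \in cs & follows c u v \/ follows c v u.

(** A cycle of length #|T| meets every vertex once, so the r positions over a
    fixed vertex [t0] lie on r different cycles, which are all the cycles. *)
Lemma dec_ham_split (T : finType) (e : T -> T -> Prop) r (t0 : T) :
  decomposes e r #|T| ->
  exists cs : seq (seq T), [/\ size cs = r, all (@hamiltonian T) cs
    & forall u v, e u v -> union_ham cs u v].
Proof.
move=> [X [s [loc [h1 h2 h3 h4]]]].
have T0 : 0 < #|T| by apply/card_gt0P; exists t0.
pose p x := [seq loc (iter i s x) | i <- iota 0 #|T|].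
have iterK i j x : i <= j -> loc (iter i s x) = loc (iter j s x) -> #|T| %| j - i.
  by move=> lij; rewrite -{1}(subnK lij) iterD => /esym /h2.
have pham x : hamiltonian (p x).
  have up : uniq (p x).
    apply/(uniqP (loc x)) => i j; rewrite !inE size_map size_iota => li lj.
    rewrite !(nth_map 0) ?size_iota // !nth_iota // !add0n => e'.
    wlog le_ij : i j li lj e' / i <= j.
      by move=> W; case: (leqP i j) => [|/ltnW] h; [|symmetry]; apply: W.
    have := iterK _ _ _ le_ij e'; move/dvdn_leq; move: li lj; lia.
  rewrite /hamiltonian up; apply/forallP => x'.
  have [_ ->] : p x =i [seq y <- p x | true] /\ p x =i T.
    split; first by move=> y; rewrite filter_predT.
    apply/subset_cardP; last by apply/subsetP.
    by rewrite (card_uniqP up) size_map size_iota.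
  by [].
have nthp x i : i < #|T| -> nth t0 (p x) i = loc (iter i s x).
  by move=> li; rewrite (nth_map 0) ?size_iota // nth_iota.
have sizep x : size (p x) = #|T| by rewrite size_map size_iota.
exists [seq p x | x <- enum [set x | loc x == t0]]; split.
- by rewrite size_map -cardE h3.
- by apply/allP => c /mapP[x _ ->].
have key x : union_ham [seq p x | x <- enum [set x | loc x == t0]] (loc x) (loc (s x)).
  have : t0 \in p x by apply: ham_mem.
  case/mapP=> i; rewrite mem_iota /= add0n => li et.
  pose y := iter i s x.
  exists (p y); first by apply: map_f; rewrite mem_enum inE /y -et.
  left; rewrite /follows.
  pose k := (#|T| - i) %% #|T|.
  have itk : iter k s y = x.
    rewrite /k; case: (posnP i) => [i0|i0]; first by rewrite /y i0 subn0 modnn.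
    rewrite modn_small; last lia.
    by rewrite /y -iterD subnK ?h1 // ltnW.
  have lk : k < #|T| by rewrite ltn_mod.
  rewrite -{1}itk -nthp // next_nth_mod ?sizep ?ham_uniq //.
  have it_mod n z : iter (n %% #|T|) s z = iter n s z.
    rewrite {2}(divn_eq n #|T|) addnC iterD; congr iter.
    by elim: (n %/ #|T|) => //= m IH; rewrite mulSn iterD -IH h1.
  by rewrite nthp ?ltn_mod // it_mod /= itk.
move=> u v /h4 [x [[<- <-]|[<- <-]]]; first exact: key.
by have [c cin h] := key x; exists c => //; case: h; [right|left].
Qed.

(** If a graph on N vertices splits into r Hamiltonian cycles, its power splits
    into r tori over a ring of length N, one for each cycle used in all the
    coordinates. *)
Lemma dec_class_split (J Y : finType) (e : Y -> Y -> Prop) N b r l (y0 : Y) :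
  #|Y| = N -> decomposes e r N ->
  decomposes (gpower (I := J) (fun u v : 'I_N => ordS u = v)) b l ->
  decomposes (gpower (I := J) e) (r * b) l.
Proof.
move=> cY /[dup] de; rewrite -{1}cY => /(dec_ham_split y0) [cs [szc hams cov]] dN.
have : decomposes (gpower (I := J) (union_ham cs)) (size cs * b) l.
  elim: cs hams {cov szc} => [|c cs IH] /= hams.
    apply: dec_sub (dec0 _ _) => u v [i [[c]]]; by rewrite in_nil.
  case/andP: hams => hc /IH {}IH; rewrite mulSn.
  have [f [fbij fS _ _]] := ham_iso hc y0 cY.
  have dc : decomposes (gpower (I := J) (follows c)) b l by apply: dec_pw_iso fbij _ dN.
  apply: dec_sub (dec_union (dec_sym dc) IH) => u v [i [[c' c'in h] huv]].
  move: c'in; rewrite inE => /predU1P[e'|c'in].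
    left; rewrite e' in h; case: h => h; [left|right]; exists i; split=> //.
    by move=> j /huv.
  by right; exists i; split=> //; exists c'.
rewrite szc; apply: dec_sub => u v [i [h huv]]; exists i; split=> //.
exact: cov.
Qed.

(** * Counting by fibers *)
Lemma card_fibers (A B : finType) (D : {set A}) (C : {set B}) (g : A -> B) :
  (forall a, a \in D -> g a \in C) ->
  #|D| = \sum_(b in C) #|[set a in D | g a == b]|.
Proof.
move=> DC; rewrite -sum1_card (partition_big g (mem C)) //=.
apply: eq_bigr => b _; rewrite -sum1_card; apply: eq_bigl => a.
by rewrite !inE.
Qed.

Lemma leq_card_fibers (A B : finType) (D : {set A}) (C : {set B}) (g : A -> B) m :
  (forall a, a \in D -> g a \in C) ->
  (forall b, #|[set a in D | g a == b]| <= m) -> #|D| <= #|C| * m.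
Proof.
move=> DC hm; rewrite (card_fibers DC) -sum_nat_const.
by apply: leq_sum.
Qed.

(** * Hall's marriage theorem *)
Section Hall.
Variables (A B : finType) (r : A -> B -> bool) (b0 : B).

Definition neighbours (S : {set A}) := [set b | [exists a in S, r a b]].

Lemma neighboursU S S' : neighbours (S :|: S') = neighbours S :|: neighbours S'.
Proof.
apply/setP => b; rewrite !inE; apply/exists_inP/orP.
  by case=> a; rewrite inE => /orP[] ha hab; [left|right]; apply/exists_inP; exists a.
by case=> /exists_inP[a ha hab]; exists a; rewrite // inE ha ?orbT.
Qed.

(** Induction on [D], inside the set [C] of elements that are still available.
    If some proper nonempty part S of [D] has exactly #|S| available neighbours,
    S is matched with these and the rest of [D] keeps Hall's condition with the
    others.  If there is no such S, any element can be matched with any of its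
    available neighbours. *)
Lemma hall_in n (D : {set A}) (C : {set B}) : #|D| <= n ->
  (forall S : {set A}, S \subset D -> #|S| <= #|neighbours S :&: C|) ->
  exists f : A -> B, {in D &, injective f} /\
    forall a, a \in D -> (f a \in C) && r a (f a).
Proof.
elim: n D C => [|n IHn] D C leD hallD.
  have D0 : D = set0 by apply/eqP; rewrite -cards_eq0 -leqn0.
  by exists (fun=> b0); rewrite D0; split=> [a a'|a]; rewrite inE.
have [D0|/set0Pn[a0 a0D]] := eqVneq D set0.
  by exists (fun=> b0); rewrite D0; split=> [a a'|a]; rewrite inE.
case: (boolP [exists S : {set A}, [&& S \subset D, S != set0, S != D
                                    & #|neighbours S :&: C| <= #|S|]]).
  case/existsP=> S /and4P[SD S0 SnD tight].
  have ltS : #|S| < #|D| by apply: proper_card; rewrite properEneq SnD.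
  have posS : 0 < #|S| by rewrite card_gt0.
  have [f1 [inj1 f1P]] : exists f : A -> B, {in S &, injective f} /\
      forall a, a \in S -> (f a \in C) && r a (f a).
    apply: IHn; first by lia.
    by move=> S' S'S; apply: hallD; apply: subset_trans SD.
  have [f2 [inj2 f2P]] : exists f : A -> B, {in D :\: S &, injective f} /\
      forall a, a \in D :\: S -> (f a \in C :\: neighbours S) && r a (f a).
    apply: IHn; first by rewrite cardsDS //; lia.
    move=> S' S'DS.
    have dis : [disjoint S & S'].
      by rewrite disjoint_sym; move: S'DS; rewrite subsetD => /andP[].
    have /hallD : S :|: S' \subset D.
      by rewrite subUset SD (subset_trans S'DS) // subsetDl.
    have -> : #|S :|: S'| = #|S| + #|S'|.
      by rewrite cardsU disjoint_setI0 // cards0 subn0.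
    rewrite neighboursU setIUl => h.
    have : #|neighbours S :&: C :|: neighbours S' :&: C| <=
        #|neighbours S :&: C| + #|neighbours S' :&: (C :\: neighbours S)|.
      apply: leq_trans (leq_card_setU _ _); apply: subset_leq_card.
      apply/subsetP => b; rewrite !inE.
      by case: (b \in C); case: [exists a in S, r a b]; rewrite ?andbF ?orbF ?andbT.
    by lia.
  have f1N a : a \in S -> f1 a \in neighbours S.
    move=> aS; rewrite inE; apply/exists_inP; exists a => //.
    by case/andP: (f1P a aS).
  exists (fun a => if a \in S then f1 a else f2 a); split.
    have cross a a' : a \in S -> a' \in D -> a' \notin S -> f1 a = f2 a' -> a = a'.
      move=> aS aD aS' e; have := f2P a'; rewrite inE aS' aD => /(_ isT).
      by rewrite inE -e f1N.
    move=> a a' aD a'D; case: ifPn => aS; case: ifPn => a'S.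
    - exact: inj1.
    - exact: cross.
    - by move=> /esym /cross e; rewrite e.
    - by apply: inj2; rewrite inE ?aS ?a'S.
  move=> a aD; case: ifPn => aS; first exact: f1P.
  have := f2P a; rewrite inE aS aD => /(_ isT) /andP[].
  by rewrite inE => /andP[_ ->].
rewrite negb_exists => /forallP slack.
have : 0 < #|neighbours [set a0] :&: C|.
  by apply: leq_trans (hallD _ _); rewrite ?cards1 // sub1set.
case/card_gt0P=> b; rewrite !inE => /andP[/exists_inP[a1]].
rewrite inE => /eqP -> rab bC.
have [f [injf fP]] : exists f : A -> B, {in D :\ a0 &, injective f} /\
    forall a, a \in D :\ a0 -> (f a \in C :\ b) && r a (f a).
  apply: IHn; first by move: leD; rewrite (cardsD1 a0 D) a0D.
  move=> S SD; have [->|S0] := eqVneq S set0; first by rewrite cards0.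
  have := slack S; rewrite S0 (subset_trans SD (subD1set _ _)) /=.
  have -> /= : S != D.
    by apply: contraTneq SD => ->; apply/subsetPn; exists a0; rewrite // !inE eqxx.
  rewrite -ltnNge => lt.
  have : #|neighbours S :&: C| <= #|[set b]| + #|neighbours S :&: (C :\ b)|.
    apply: leq_trans (leq_card_setU _ _); apply: subset_leq_card.
    by apply/subsetP => b'; rewrite !inE; case: (b' == b) => //=.
  by rewrite cards1; lia.
exists (fun a => if a == a0 then b else f a); split.
  have cross a : a \in D -> a != a0 -> f a != b.
    by move=> aD na; have := fP a; rewrite !inE na aD => /(_ isT) /andP[/andP[]].
  move=> a a' aD a'D; case: eqVneq => [->|na]; case: eqVneq => [->|na'] //.
  - by move/eqP; rewrite eq_sym (negPf (cross _ a'D na')).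
  - by move/eqP; rewrite (negPf (cross _ aD na)).
  - by apply: injf; rewrite !inE ?na ?na'.
move=> a aD; case: eqVneq => [->|na]; first by rewrite bC.
by have := fP a; rewrite !inE na aD => /(_ isT) /andP[/andP[_ ->]].
Qed.

End Hall.

Lemma hall (A B : finType) (r : A -> B -> bool) :
  (forall S : {set A}, #|S| <= #|neighbours r S|) ->
  exists2 f : A -> B, injective f & forall a, r a (f a).
Proof.
move=> hallA; case: (pickP B) => [b0 _|B0].
  have [||f [finj fP]] := @hall_in _ _ r b0 #|A| setT setT.
  - by rewrite cardsT.
  - by move=> S _; rewrite setIT.
  exists f; first by move=> a a'; apply: finj.
  by move=> a; have /andP[] := fP a (in_setT a).
have A0 : A -> False.
  move=> a; have := hallA [set a]; rewrite cards1 card_gt0 => /set0Pn[b].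
  by have := B0 b.
by exists (fun a => match A0 a with end) => a; case: (A0 a).
Qed.

(** Giving each cycle the share 1/r of each of its vertices is a fractional
    choice with P vertices per cycle; Hall's theorem makes it integral.  The
    cycle through x is listed as [iter i.+1 s x] for i < P * r, and its chosen
    vertices are numbered by [slot]: each k < P is the number of exactly one
    of them. *)
Lemma even_selection (T X : finType) (s : X -> X) (loc : X -> T) P r :
  0 < P -> 0 < r ->
  (forall x, iter (P * r) s x = x) ->
  (forall x i, loc (iter i s x) = loc x -> P * r %| i) ->
  (forall v, #|[set x | loc x == v]| = r) ->
  exists (sel : T -> X) (slot : T -> 'I_P),
    (forall v, loc (sel v) = v) /\
    forall x k, exists i0 : 'I_(P * r), forall i : 'I_(P * r),
      let y := iter i.+1 s x in
      (sel (loc y) == y) && (slot (loc y) == k) = (i == i0).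
Proof.
move=> P0 r0 sK sloc fib; set l := P * r in sK sloc *.
have l0 : 0 < l by rewrite muln_gt0 P0.
have s_inj : injective s.
  by apply: (can_inj (g := iter l.-1 s)) => x; rewrite -iterSr prednK ?sK.
have csym := fconnect_sym s_inj.
have it_inj x i j : i < l -> j < l -> loc (iter i s x) = loc (iter j s x) -> i = j.
  move=> li lj e; wlog le_ij : i j li lj e / i <= j.
    by move=> W; case: (leqP i j) => [|/ltnW] h; [|symmetry]; apply: W.
  move: e; rewrite -{1}(subnK le_ij) iterD => /esym /sloc /dvdn_leq.
  by lia.
have it_mod n x : iter (n %% l) s x = iter n s x.
  rewrite {2}(divn_eq n l) addnC iterD; congr iter.
  by elim: (n %/ l) => //= m IH; rewrite mulSn iterD -IH sK.
have conn_it x y : fconnect s x y -> exists i : 'I_l, y = iter i s x.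
  move=> /iter_findex e; exists (Ordinal (ltn_pmod (findex s x y) l0)).
  by rewrite /= it_mod e.
have card_orbit x : #|[set y | froot s y == froot s x]| = l.
  have -> : [set y | froot s y == froot s x] = [set iter (i : 'I_l) s x | i in 'I_l].
    apply/setP=> y; rewrite inE root_connect // csym; apply/idP/imsetP.
      by case/conn_it=> i ->; exists i.
    by case=> i _ ->; apply: fconnect_iter.
  rewrite card_imset ?card_ord // => i j e; apply: val_inj.
  by apply: (it_inj x); rewrite ?ltn_ord ?e.
pose R := [set b : X * 'I_P | froots s b.1].
have card_fib (S : {set T}) : #|[set z : X * 'I_P | loc z.1 \in S]| = #|S| * l.
  rewrite (@card_fibers _ _ _ S (fun z => loc z.1)); last by move=> z; rewrite inE.
  rewrite -sum_nat_const; apply: eq_bigr => v vS.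
  rewrite /l mulnC -(fib v) -[P in RHS]card_ord -cardsT -cardsX.
  by apply: eq_card => -[z k]; rewrite !inE /=; case: eqP => [->|]; rewrite ?vS ?andbF.
have card_R : #|R| * l <= #|T| * l.
  rewrite -cardsT -card_fib.
  rewrite [X in _ <= X](@card_fibers _ _ _ R (fun z => (froot s z.1, z.2))); last first.
    by move=> z _; rewrite inE /= roots_root.
  rewrite -sum_nat_const; apply: leq_sum => -[y k]; rewrite inE /= => /eqP ry.
  rewrite -(card_orbit y) -(card_imset _ (f := fun z => (z, k))); last by move=> ? ? [].
  apply: subset_leq_card; apply/subsetP => _ /imsetP[z + ->].
  by rewrite !inE /= => /eqP ->; rewrite xpair_eqE ry !eqxx.
pose r' (v : T) (b : X * 'I_P) := [exists z, (loc z == v) && (froot s z == b.1)].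
have [f f_inj fP] : exists2 f : T -> X * 'I_P, injective f & forall v, r' v (f v).
  apply: hall => S; rewrite -(leq_pmul2r l0) -card_fib.
  apply: (leq_card_fibers (g := fun z => (froot s z.1, z.2))).
    move=> z; rewrite !inE => zS; apply/exists_inP; exists (loc z.1) => //.
    by apply/existsP; exists z.1; rewrite !eqxx.
  move=> [y k]; have [ry|ry] := eqVneq (froot s y) y; last first.
    apply: leq_trans (leq0n l); rewrite leqn0 cards_eq0 -subset0; apply/subsetP => z; rewrite !inE.
    rewrite xpair_eqE => /andP[_ /andP[/eqP e]]; case/eqP: ry.
    by rewrite -e root_root.
  rewrite -(card_orbit y) -[X in _ <= X](card_imset _ (f := fun z => (z, k))); last by move=> ? ? [].
  apply: subset_leq_card; apply/subsetP => -[z k'].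
  rewrite !inE xpair_eqE /= => /and3P[_ /eqP e /eqP ->].
  by apply/imsetP; exists z; rewrite ?inE // e ry.
have f_onto b : froots s b.1 -> exists v, f v = b.
  move=> rb; have : b \in [set f v | v in T].
    have /eqP -> : [set f v | v in T] == R.
      rewrite eqEcard card_imset // -(leq_pmul2r l0) card_R andbT.
      apply/subsetP => _ /imsetP[v _ ->]; rewrite inE.
      by have /existsP[z /andP[_ /eqP <-]] := fP v; apply: roots_root.
    by rewrite inE.
  by case/imsetP=> v _ ->; exists v.
have [sel selP] : exists sel : T -> X,
    forall v, (loc (sel v) == v) && (froot s (sel v) == (f v).1).
  exists (fun v => xchoose (existsP (fP v))) => v.
  exact: (xchooseP (existsP (fP v))).
exists sel, (fun v => (f v).2); split=> [v|x k].
  by have /andP[/eqP] := selP v.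
have [v fv] := f_onto (froot s (s x), k) (roots_root csym (s x)).
have [/eqP lv /eqP rv] := andP (selP v); rewrite fv /= in rv.
have /conn_it[i0 e0] : fconnect s (s x) (sel v).
  by rewrite -(root_connect csym) rv.
exists i0 => i /=; rewrite -iterS iterSr; apply/andP/eqP => [[/eqP e1 /eqP e2]|->].
  have /f_inj e : f (loc (iter i s (s x))) = f v.
    have /andP[_ /eqP e3] := selP (loc (iter i s (s x))).
    rewrite fv -e2 [LHS]surjective_pairing -e3 e1; congr (_, _).
    by apply/eqP; rewrite root_connect // csym fconnect_iter.
  apply: val_inj; apply: (it_inj (s x)); rewrite ?ltn_ord //.
  by rewrite e -e0 lv.
by rewrite -e0 lv fv.
Qed.

(** * Weaving cycles with a ring *)

(** A strand at height y follows a cycle of the base graph.  Reaching a chosen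
    position, it takes the ring edge above the chosen vertex, up or down
    according to the number of that vertex (down for the first m of the P
    numbers), and then goes on along the same cycle.  All strands move in the
    same direction at a given vertex, so each ring edge is used once. *)
Section Weave.
Import GRing.Theory.
Local Open Scope ring_scope.
Variables (V X : finType) (s : X -> X) (loc : X -> V) (P r n m kappa : nat).
Variables (sel : V -> X) (slot : V -> 'I_P).
Let l := (P * r)%N.
Hypothesis sK : forall x, iter l s x = x.
Hypothesis sloc : forall x i, loc (iter i s x) = loc x -> (l %| i)%N.
Hypothesis selK : forall v, loc (sel v) = v.
Hypothesis slotP : forall x k, exists i0 : 'I_l, forall i : 'I_l,
      let y := iter i.+1 s x in
      (sel (loc y) == y) && (slot (loc y) == k) = (i == i0).
Hypothesis even_n : ~~ odd n.
Hypothesis even_P : ~~ odd P.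
Hypothesis le_m : (m.*2 <= P)%N.
Hypothesis kappaP : forall t, (n.+2 %| (P - m.*2) * t)%N = (kappa %| t)%N.
Notation Y := 'I_n.+2.

Let chosen x := sel (loc x) == x.
Let shift (k : 'I_P) : Y := if (k < m)%N then -1 else 1.
Let drift x : Y := if chosen x then shift (slot (loc x)) else 0.
Let nchosen k x := (\sum_(i < k) chosen (iter i.+1 s x))%N.
Let height k x := \sum_(i < k) drift (iter i.+1 s x).
Let rise : Y := (P - m.*2)%:R.

(** One turn of a cycle meets each of the numbers k < P exactly once. *)
Lemma sum_over_cycle (R : Type) (idx : R) (op : Monoid.com_law idx)
    (g : 'I_P -> R) x :
  \big[op/idx]_(i < l) (if chosen (iter i.+1 s x) then g (slot (loc (iter i.+1 s x))) else idx)
    = \big[op/idx]_k g k.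
Proof.
rewrite -big_mkcond (partition_big (fun i : 'I_l => slot (loc (iter i.+1 s x))) xpredT) //=.
apply: eq_bigr => k _; have [i0 hi0] := slotP x k.
rewrite (big_pred1 i0) => [|i]; last by rewrite /chosen hi0.
by have := hi0 i0; rewrite eqxx => /andP[_ /eqP ->].
Qed.

Lemma height_cycle x : height l x = rise.
Proof.
rewrite /height /drift (sum_over_cycle _ shift) /rise.
have le_mP : (m <= P)%N by lia.
rewrite -(big_mkord xpredT (fun k => if (k < m)%N then -1 else 1 : Y)).
rewrite (big_cat_nat (n := m)) //= (eq_big_nat _ _ (F2 := fun=> -1)); last first.
  by move=> i /andP[_ ->].
rewrite [X in _ + X](eq_big_nat _ _ (F2 := fun=> 1)); last first.
  by move=> i /andP[+ _]; rewrite leqNgt => /negPf ->.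
rewrite !sumr_const_nat subn0 mulNrn addrC -mulrnBr; last lia.
by congr (_ *+ _); lia.
Qed.

Lemma nchosen_cycle x : nchosen l x = P.
Proof.
rewrite /nchosen -[RHS]card_ord -sum1_card -(sum_over_cycle _ (fun=> 1%N) x).
by apply: eq_bigr => i _; case: chosen.
Qed.

Lemma heightD k k' x : height (k + k') x = height k x + height k' (iter k s x).
Proof.
rewrite /height big_split_ord; congr (_ + _); apply: eq_bigr => i _.
by rewrite -[in RHS]iterD; congr (drift (iter _ s x)); rewrite /= addSn addnC.
Qed.

Lemma nchosenD k k' x : nchosen (k + k') x = (nchosen k x + nchosen k' (iter k s x))%N.
Proof.
rewrite /nchosen big_split_ord; congr (_ + _)%N; apply: eq_bigr => i _.
by rewrite -[in RHS]iterD; congr (nat_of_bool (chosen (iter _ s x))); rewrite /= addSn addnC.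
Qed.

Lemma it_cycles t x : iter (t * l) s x = x.
Proof. by elim: t => //= t IH; rewrite mulSn iterD IH sK. Qed.

Lemma height_cycles t x : height (t * l) x = rise *+ t.
Proof.
elim: t => [|t IH]; first by rewrite /height big_ord0.
by rewrite mulSn heightD height_cycle sK IH mulrS.
Qed.

Lemma nchosen_cycles t x : nchosen (t * l) x = (t * P)%N.
Proof.
elim: t => [|t IH]; first by rewrite /nchosen big_ord0.
by rewrite mulSn nchosenD nchosen_cycle sK IH mulSn.
Qed.

(** A position of the woven system is either on a horizontal edge, starting at
    [loc x] at height y, or on the ring edge that the strand takes at v. *)
Definition weave_next (z : X * Y + V * Y) : X * Y + V * Y :=
  match z with
  | inl (x, y) => if chosen (s x) then inr (loc (s x), y) else inl (s x, y)
  | inr (v, y) => inl (sel v, y + shift (slot v))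
  end.
Definition weave_loc (z : X * Y + V * Y) : V * Y :=
  match z with inl (x, y) => (loc x, y) | inr z => z end.
Lemma height_S k x : height k.+1 x = height k x + drift (iter k.+1 s x).
Proof. by rewrite /height big_ord_recr. Qed.
Lemma nchosen_S k x : nchosen k.+1 x = (nchosen k x + chosen (iter k.+1 s x))%N.
Proof. by rewrite /nchosen big_ord_recr. Qed.

(** A passage through a chosen position costs one step more. *)
Lemma run k x y : iter (k + nchosen k x) weave_next (inl (x, y)) = inl (iter k s x, y + height k x).
Proof.
elim: k => [|k IH]; first by rewrite /nchosen /height !big_ord0 addr0.
rewrite nchosen_S height_S /drift addSn addnA; case: ifPn => h.
  by rewrite addn1 !iterS IH /= h /weave_next (eqP h) addrA.
by rewrite addn0 !iterS IH /= (negPf h) addr0.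
Qed.

Lemma run_chosen k x y : chosen (iter k.+1 s x) ->
  iter (k + nchosen k x).+1 weave_next (inl (x, y)) = inr (loc (iter k.+1 s x), y + height k x).
Proof. by move=> h; rewrite iterS run /= h. Qed.

Lemma time_split i x : (exists k, i = k + nchosen k x)%N \/
  (exists2 k, i = (k + nchosen k x).+1 & chosen (iter k.+1 s x)).
Proof.
elim: i => [|i [[k IH]|[k IH h]]].
- by left; exists 0%N; rewrite /nchosen big_ord0.
- case: (boolP (chosen (iter k.+1 s x))) => h; first by right; exists k; rewrite ?IH.
  by left; exists k.+1; rewrite nchosen_S (negPf h) IH addn0.
- by left; exists k.+1; rewrite nchosen_S h IH; lia.
Qed.

Lemma natr_ord_eq0 k : (k%:R == 0 :> Y) = (n.+2 %| k)%N.
Proof. by rewrite Zp_nat. Qed.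

Lemma rise_cycles_eq0 t : (rise *+ t == 0) = (kappa %| t)%N.
Proof. by rewrite -mulrnA natr_ord_eq0 kappaP. Qed.

(** The total rise is even and a single step is odd, also modulo the even
    length of the ring: a strand never comes back to a chosen vertex just
    before or after taking the ring edge there. *)
Lemma drift_odd x t : chosen x -> rise *+ t + drift x != 0.
Proof.
move=> h; rewrite /drift h.
have [w oddw ->] : exists2 w, odd w & shift (slot (loc x)) = w%:R.
  rewrite /shift; case: ifP => _; last by exists 1%N.
  exists n.+1; first by rewrite /= even_n.
  apply/eqP; rewrite eq_sym -addr_eq0 -[X in _ + X]/(1%:R) -natrD addn1.
  by rewrite natr_ord_eq0.
rewrite -mulrnA -natrD natr_ord_eq0; apply: contraL oddw => dv.
have : (2 %| (P - m.*2) * t + w)%N.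
  by apply: dvdn_trans dv; rewrite dvdn2 /= negbK.
by rewrite dvdn2 oddD oddM oddB // (negPf even_P) odd_double.
Qed.

Lemma drift_neq x t : chosen x -> drift x != rise *+ t.
Proof.
move=> h; apply: contra (drift_odd (t * n.+1) h) => /eqP ->.
by rewrite -mulrnDr addnC -mulnS -mulrnA natr_ord_eq0 mulnA dvdn_mull.
Qed.

Lemma weave_iter z : iter ((l + P) * kappa) weave_next z = z.
Proof.
have base x y : iter ((l + P) * kappa) weave_next (inl (x, y)) = inl (x, y).
  have -> : ((l + P) * kappa = kappa * l + nchosen (kappa * l) x)%N.
    by rewrite nchosen_cycles; lia.
  rewrite run it_cycles height_cycles.
  by have /eqP -> : rise *+ kappa == 0; rewrite ?addr0 // rise_cycles_eq0.
case: z => [[x y]|[v y]] //.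
(* The position before sel v, from which the ring edge at v is entered. *)
pose x0 := iter l.-1 s (sel v).
have [l0|l0] := posnP l.
  by have := slotP (sel v) (slot v); rewrite l0 => -[[]].
have sx0 : s x0 = sel v by rewrite /x0 -iterS prednK.
have -> : inr (v, y) = weave_next (inl (x0, y)) by rewrite /= sx0 /chosen selK eqxx.
by rewrite -iterSr iterS base.
Qed.

(** A strand that returns to a vertex has made whole turns, whose number is a
    multiple of [kappa] because the height is the same. *)
Lemma weave_inj z i : weave_loc (iter i weave_next z) = weave_loc z -> ((l + P) * kappa %| i)%N.
Proof.
have shift0 (y w : Y) : y + w = y -> w = 0 by move/(canRL (addKr y)); rewrite addNr.
have concl t : rise *+ t = 0 -> ((l + P) * kappa %| t * l + t * P)%N.
  by move/eqP; rewrite rise_cycles_eq0 -mulnDr mulnC => h; apply: dvdn_mul.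
case: z => [[x y]|[v y]].
  case: (time_split i x) => [[k ->]|[k -> h]].
    rewrite run /= => -[e1 e2]; have /dvdnP[t kt] := sloc e1.
    move/shift0: e2; rewrite kt.
    by rewrite height_cycles nchosen_cycles; apply: concl.
  rewrite run_chosen // [weave_loc _]/= => -[e1 e2].
  have /dvdnP[t kt] := @sloc x k.+1 e1; move/shift0: e2 => Wk0.
  have := height_S k x; rewrite kt height_cycles Wk0 add0r -kt => /eqP.
  by rewrite eq_sym (negPf (drift_neq _ h)).
(* The position before sel v, from which the ring edge at v is entered. *)
pose x0 := iter l.-1 s (sel v).
have [l0|l0] := posnP l.
  by have := slotP (sel v) (slot v); rewrite l0 => -[[]].
have sx0 : s x0 = sel v by rewrite /x0 -iterS prednK.
have ch : chosen (sel v) by rewrite /chosen selK.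
have -> : inr (v, y) = weave_next (inl (x0, y)) by rewrite /= sx0 ch selK.
rewrite -iterSr.
have -> : weave_loc (weave_next (inl (x0, y))) = (v, y) by rewrite /= sx0 ch /= selK.
have back k : loc (iter k.+1 s x0) = v -> exists t, k = (t * l)%N.
  by rewrite iterSr sx0 -[in RHS](selK v) => e; apply/dvdnP; apply: sloc e.
case: (time_split i.+1 x0) => [[k ik]|[k [->] h]].
  rewrite ik run /= => -[]; case: k ik => [|k] ik e1 e2.
    by move: ik; rewrite /nchosen big_ord0.
  have [t kt] := back _ e1; move/shift0/eqP: e2.
  rewrite height_S kt height_cycles -kt iterSr kt it_cycles sx0.
  by rewrite (negPf (drift_odd _ ch)).
rewrite run_chosen // [weave_loc _]/= => -[e1 e2].
have [t kt] := back _ e1; move/shift0: e2; rewrite kt.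
by rewrite height_cycles nchosen_cycles; apply: concl.
Qed.

Lemma dec_weave (e : V -> V -> Prop) :
  (forall v, #|[set x | loc x == v]| = r) ->
  (forall u v, e u v -> traverses s loc u v) ->
  decomposes (cart e (fun u v : Y => ordS u = v)) r.+1 ((l + P) * kappa).
Proof.
move=> fib cov; exists (X * Y + V * Y)%type, weave_next, weave_loc; split.
- exact: weave_iter.
- exact: weave_inj.
- move=> [v y]; rewrite -[r.+1]addn1 -(fib v) -sum1_card big_sumType /=; congr (_ + _)%N.
    rewrite sum1dep_card -[RHS](card_imset _ (f := fun x => (x, y))); last by move=> ? ? [].
    apply: eq_card => -[x y']; rewrite !inE; apply/eqP/imsetP => [[<- <-]|[x']].
      by exists x; rewrite ?inE.
    by rewrite inE => /eqP <- [-> ->].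
  by rewrite (big_pred1 (v, y)) // => z; rewrite inE.
have weave_locS x y : weave_loc (weave_next (inl (x, y))) = (loc (s x), y) by rewrite /=; case: ifP.
move=> [u y] [v y'] [[/= /cov [x hx] <-]|[/= <- <-]].
  by exists (inl (x, y)); rewrite weave_locS /=; case: hx => -[-> ->]; [left|right].
have -> : ordS y = y + 1 by apply: val_inj; rewrite /= modnDmr addn1.
case: (ltnP (slot u) m) => h.
  exists (inr (u, y + 1)); right; split=> //=.
  by rewrite /shift h addrK selK.
exists (inr (u, y)); left; split=> //=.
by rewrite /shift ltnNge h selK.
Qed.

End Weave.

(** The total rise of one turn is P - 2m, and [kappa] is its order modulo N. *)
Lemma dec_weave_cycle (V : finType) (e : V -> V -> Prop) P r N m kappa :
  0 < r -> 1 < N -> ~~ odd N -> 0 < P -> ~~ odd P -> m.*2 <= P ->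
  (forall t, (N %| (P - m.*2) * t) = (kappa %| t)) ->
  decomposes e r (P * r) ->
  decomposes (cart e (fun u v : 'I_N => ordS u = v)) r.+1 ((P * r + P) * kappa).
Proof.
case: N => [|[|n]] // r0 _ oN P0 oP lem kP [X [s [loc [h1 h2 h3 h4]]]].
have [sel [slot [selK slotP]]] := even_selection P0 r0 h1 h2 h3.
by apply: (dec_weave h1 h2 selK slotP) => //; move: oN; rewrite /= negbK.
Qed.

(** * Tori over a ring whose length is a power of two *)
Definition ring_step N (u v : 'I_N) : Prop := ordS u = v.

Definition torus_dec b q l : Prop :=
  forall I : finType, #|I| = b -> decomposes (gpower (I := I) (@ring_step (2 ^ q))) b l.

Lemma torus_decI (I : finType) b q l :
  #|I| = b -> decomposes (gpower (I := I) (@ring_step (2 ^ q))) b l -> torus_dec b q l.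
Proof. by move=> cI d J cJ; apply: dec_pw_reindex d; rewrite cI. Qed.

Lemma torus_dec1 q : torus_dec 1 q (2 ^ q).
Proof. by move=> I cI; apply: dec_pw1 => //; apply: ham_ord; rewrite expn_gt0. Qed.

Lemma torus_decD b q l : torus_dec b q l -> torus_dec (b + b) q l.
Proof.
move=> d; apply: (torus_decI (I := ('I_b + 'I_b)%type)); first by rewrite card_sum !card_ord.
by apply/dec_pw_sum/dec_cart; apply: d; rewrite card_ord.
Qed.

(** Pairs of coordinates over the short ring are replaced by one coordinate over
    either of the two Hamiltonian cycles of the product of two rings. *)
Lemma torus_dec_double b q l :
  torus_dec 2 q (2 ^ q.*2) -> torus_dec b q.*2 l -> torus_dec (b * 2) q l.
Proof.
move=> d2 db; apply: (torus_decI (I := ('I_b * bool)%type)).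
  by rewrite card_prod card_ord card_bool.
rewrite mulnC; apply: dec_pw_curry.
apply: (dec_class_split (N := 2 ^ q.*2)).
- by apply: [ffun => Ordinal (expn_gt0 2 q)].
- by rewrite card_ffun card_bool card_ord -expnM muln2.
- by apply: d2; rewrite card_bool.
- by apply: db; rewrite card_ord.
Qed.

Lemma torus_dec_weave r p q m kappa : 0 < r -> 0 < p -> 0 < q -> m.*2 <= 2 ^ p ->
  (forall t, (2 ^ q %| (2 ^ p - m.*2) * t) = (kappa %| t)) ->
  torus_dec r q (2 ^ p * r) -> torus_dec r.+1 q ((2 ^ p * r.+1) * kappa).
Proof.
move=> r0 p0 q0 lem kP d.
apply: (torus_decI (I := ('I_r + unit)%type)); first by rewrite card_sum card_ord card_unit addn1.
apply: dec_pw_sum.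
have d1 := d 'I_r (card_ord r).
have odd2 k : 0 < k -> ~~ odd (2 ^ k) by case: k => // k _; rewrite expnS oddM.
have := dec_weave_cycle r0 _ (odd2 _ q0) _ (odd2 _ p0) lem kP d1.
rewrite !expn_gt0 -{1}(expn0 2) ltn_exp2l // mulnSr => /(_ q0 isT).
apply: (dec_iso (f := fun z : {ffun 'I_r -> 'I_(2 ^ q)} * {ffun unit -> 'I_(2 ^ q)} =>
  (z.1, z.2 tt))).
  exists (fun z => (z.1, [ffun => z.2])) => -[x y]; last by rewrite ffunE.
  by congr (_, _); apply/ffunP => -[]; rewrite ffunE.
move=> [x y] [x' y'] [[/= h ->]|[/= -> [[] [h _]]]]; by [left|right].
Qed.

(** Half of the moves go up and half go down: every strand closes after one
    turn. *)
Lemma torus_dec_flat r p q : 0 < r -> 0 < p -> 0 < q ->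
  torus_dec r q (2 ^ p * r) -> torus_dec r.+1 q (2 ^ p * r.+1).
Proof.
move=> r0 p0 q0 d; rewrite -[2 ^ p * _]muln1.
have P2 : (2 ^ p.-1).*2 = 2 ^ p by rewrite -muln2 -expnSr prednK.
apply: (torus_dec_weave (m := 2 ^ p.-1)) => // [|t]; first by rewrite P2.
by rewrite P2 subnn mul0n dvdn0 dvd1n.
Qed.

(** The moves of a turn add up to 2^k, which has order 2^(q - k). *)
Lemma torus_dec_spiral r p q k : 0 < r -> 0 < k <= p -> k <= q ->
  torus_dec r q (2 ^ p * r) -> torus_dec r.+1 q (2 ^ (p + q - k) * r.+1).
Proof.
move=> r0 /andP[k0 kp] kq d.
have -> : 2 ^ (p + q - k) * r.+1 = 2 ^ p * r.+1 * 2 ^ (q - k).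
  by rewrite -addnBA // expnD mulnAC.
have D2 j : 0 < j -> (2 ^ j.-1).*2 = 2 ^ j by move=> j0; rewrite -muln2 -expnSr prednK.
have p0 : 0 < p by apply: leq_trans kp.
have EP : 2 ^ p - (2 ^ p.-1 - 2 ^ k.-1).*2 = 2 ^ k.
  by rewrite doubleB !D2 // subKn // leq_exp2l.
apply: (torus_dec_weave (m := 2 ^ p.-1 - 2 ^ k.-1)) => // [||t].
- by apply: leq_trans kq.
- by rewrite doubleB !D2 // leq_subr.
by rewrite EP -{1}(subnKC kq) expnD dvdn_pmul2l ?expn_gt0.
Qed.

Lemma torus_dec2 q a : 2 <= q -> q <= a <= q.*2 -> torus_dec 2 q (2 ^ a).
Proof.
move=> q2 /andP[]; rewrite leq_eqVlt => /predU1P[<- _|lt_a le_a].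
  exact: torus_decD (torus_dec1 q).
have -> : 2 ^ a = 2 ^ (q + q - (q.*2.+1 - a)) * 2.
  by rewrite -expnSr; congr (2 ^ _); lia.
by apply: torus_dec_spiral; rewrite ?muln1; try lia; apply: torus_dec1.
Qed.

(** Short cycles of the doubled torus are those of its two halves; long ones
    come from the ring of squared length.  The condition on [lo] and [hi] says
    that the two ranges of exponents leave no gap. *)
Lemma torus_dec_pow2 b m (lo hi : nat -> nat) :
  (forall q a, 2 <= q -> lo q <= a <= hi q -> torus_dec b q (2 ^ a * m)) ->
  (forall q, 2 <= q -> lo q.*2 <= (hi q).+1) ->
  {homo hi : q q' / q <= q'} ->
  forall j q a, 2 <= q -> lo q <= a <= hi (2 ^ j * q) ->
    torus_dec (b * 2 ^ j) q (2 ^ a * m).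
Proof.
move=> base overlap hi_mono; elim=> [|j IH] q a q2 /andP[la ua].
  by rewrite muln1; apply: base; rewrite // la -[q]mul1n.
rewrite expnSr mulnA; case: (leqP a (hi (2 ^ j * q))) => ha.
  by rewrite muln2 -addnn; apply/torus_decD/IH; rewrite ?la.
apply: torus_dec_double; first by apply: torus_dec2; lia.
apply: IH; first lia.
apply/andP; split; last by move: ua; rewrite expnSr -mulnA mul2n.
apply: leq_trans ha; apply: leq_trans (overlap _ q2) _.
by rewrite ltnS; apply: hi_mono; rewrite leq_pmull ?expn_gt0.
Qed.

(** [loss a k]: from the binary expansion of the odd number a, the longest cycles
    obtained in the a-dimensional torus over a ring of length 2^q have length
    a 2^(aq - k).  A digit reached after a shift by j divides the number P of
    chosen vertices by 2^j, and the strands come in pairs. *)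
Inductive loss : nat -> nat -> Prop :=
| loss1 : loss 1 0
| loss_step a k j : loss a k -> 0 < j -> loss (2 ^ j * a).+1 (k + j).+1.

Lemma loss_lt a k : loss a k -> k < a.
Proof.
elim=> // {}a {}k j _ IH j0; have := ltn_expl j (ltnSn 1); nia.
Qed.

(** Exponents up to 2^j a q - k - j are reached by flat weaving; the larger ones
    by spirals of rise 2, which add q - 1 to the exponent. *)
Lemma loss_step_dec a k j q :
  0 < j -> 2 <= q -> 0 < a -> k < a ->
  (forall b, q.-1 + j <= b <= 2 ^ j * a * q - k ->
     torus_dec (2 ^ j * a) q (2 ^ b * a)) ->
  forall b, q.-1 <= b <= (2 ^ j * a).+1 * q - (k + j).+1 ->
     torus_dec (2 ^ j * a).+1 q (2 ^ b * (2 ^ j * a).+1).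
Proof.
move=> j0 q2 a0 ka H b /andP[lb ub].
have ex2 := ltn_expl j (ltnSn 1).
have r0 : 0 < 2 ^ j * a by rewrite muln_gt0 expn_gt0.
have big : j + a + (q.-1).*2 <= 2 ^ j * a * q.
  have : j + a <= 2 ^ j * a by nia.
  have : 2 <= 2 ^ j * a by nia.
  by case: q q2 {H lb ub} => // q; nia.
have Hp p : q.-1 <= p -> p + j <= 2 ^ j * a * q - k ->
    torus_dec (2 ^ j * a) q (2 ^ p * (2 ^ j * a)).
  move=> lp up; rewrite mulnA -expnD; apply: H; lia.
case: (leqP (b + j) (2 ^ j * a * q - k)) => hb.
  by apply: torus_dec_flat => //; [lia|lia|apply: Hp].
have -> : b = (b - q.-1) + q - 1 by lia.
apply: torus_dec_spiral => //; [lia|lia|apply: Hp; lia].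
Qed.

(** For a' = 1 the induction hypothesis would only give the cycles of length 2^q
    in a single ring, so the product of two rings starts the doubling. *)
Lemma torus_dec_odd a k : loss a k -> 1 < a ->
  forall q b, 2 <= q -> q.-1 <= b <= a * q - k -> torus_dec a q (2 ^ b * a).
Proof.
elim=> // {}a {}k j la IH j0 _ q b q2 hb.
have ka := loss_lt la; have a0 : 0 < a by apply: leq_ltn_trans ka.
apply: loss_step_dec hb => // {}b /andP[lb ub].
case: (ltngtP a 1) => [|a1|a1]; first lia.
  rewrite mulnC; apply: (@torus_dec_pow2 a a (fun q => q.-1) (fun q => a * q - k)) => //.
  - exact: IH.
  - by move=> {lb ub b}q2'; nia.
  - by move=> q' q'' ?; rewrite leq_sub2r // leq_mul2l; apply/orP; right.
  - by rewrite mulnCA mulnA; lia.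
rewrite a1 muln1 in ub *; have k0 : k = 0 by lia.
case: j j0 lb ub => // j _ lb ub; rewrite expnS.
apply: (@torus_dec_pow2 2 1 id (fun q => q.*2)) => //.
- by move=> q' b' q2' h; rewrite muln1; apply: torus_dec2.
- by move=> q' q'' ?; rewrite leq_double.
- by move: ub; rewrite expnS k0; lia.
Qed.

(** * Switching a square *)
Lemma next_split (T : eqType) (c l1 l2 : seq T) x y :
  uniq c -> c = l1 ++ x :: y :: l2 -> next c x = y.
Proof.
move=> uc ec; rewrite -(next_rot (size l1)) // ec rot_size_cat /=.
by rewrite eqxx.
Qed.

Lemma next_last (T : eqType) (c l : seq T) x y :
  uniq c -> c = y :: rcons l x -> next c x = y.
Proof.
move=> uc ec; rewrite -(next_rot (size (y :: l))) // ec -cats1 -cat_cons.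
by rewrite rot_size_cat /= eqxx.
Qed.

Lemma fpath_split (T : eqType) (f : T -> T) a p u :
  fpath f a p -> u \in a :: p -> u != last a p ->
  exists l1 l2, a :: p = l1 ++ u :: f u :: l2.
Proof.
elim: p a => [|b p IH] a /=; first by rewrite inE => _ ->.
case/andP=> /eqP fab pth; rewrite inE => /predU1P[->|ub] ul.
  by exists [::], p; rewrite fab.
have [l1 [l2 e]] := IH b pth ub ul.
by exists (a :: l1), l2; rewrite e.
Qed.

Lemma cyclic_dec (T : finType) (f : T -> T) z :
  injective f -> (forall x, fconnect f x z) -> decomposes (fun u v => f u = v) 1 #|T|.
Proof.
move=> finj fz; have hc : hamiltonian (orbit f z).
  rewrite /hamiltonian orbit_uniq; apply/forallP => x.
  by rewrite -fconnect_orbit fconnect_sym.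
apply: dec_sub (ham_dec hc) => u v <-.
by have /eqP := next_cycle (cycle_orbit finj z) (ham_mem hc u).
Qed.

(** Two paths that share the vertices of the graph are joined into one cycle
    by following the first one forwards and the second one backwards. *)
Lemma twist_dec (T : finType) (f : T -> T) a p1 c p2 :
  fpath f a p1 -> fpath f c p2 -> hamiltonian ((a :: p1) ++ (c :: p2)) ->
  decomposes (fun u v => [\/ [/\ u != last a p1, u != last c p2 & f u = v],
                      u = last a p1 /\ v = last c p2 | u = c /\ v = a]) 1 #|T|.
Proof.
move=> path1 path2 h12; pose cy := (a :: p1) ++ rev (c :: p2).
have hcy : hamiltonian cy.
  have /permP pe : perm_eq cy ((a :: p1) ++ (c :: p2)) by rewrite perm_cat2l perm_rev.
  rewrite /hamiltonian (perm_uniq (introT permP pe)) (ham_uniq h12); apply/forallP => x.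
  by rewrite (perm_mem (introT permP pe)) (ham_mem h12).
have ucy := ham_uniq hcy.
apply: dec_sub (dec_sym (ham_dec hcy)) => u v [[nu1 nu2 <-]|[-> ->]|[-> ->]]; rewrite /follows.
- have := ham_mem h12 u; rewrite mem_cat => /orP[/(fpath_split path1)|/(fpath_split path2)].
    case/(_ nu1) => l1 [l2 e]; left.
    by apply: (@next_split _ _ l1 (l2 ++ rev (c :: p2))); rewrite // /cy e -catA.
  case/(_ nu2) => l1 [l2 e]; right.
  apply: (@next_split _ _ ((a :: p1) ++ rev l2) (rev l1)); rewrite // /cy e.
  by rewrite rev_cat !rev_cons -!cats1 -!catA.
- left; apply: (@next_split _ _ (belast a p1) (behead (rev (c :: p2)))) => //.
  rewrite /cy (lastI a p1) -cats1 -catA cat1s; congr (_ ++ _ :: _).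
  by rewrite lastI rev_rcons.
- left; apply: (@next_last _ _ (p1 ++ rev p2)) => //.
  by rewrite /cy rev_cons -rcons_cat.
Qed.

Lemma orbit_path (T : finType) (f : T -> T) x : injective f ->
  exists p, [/\ orbit f x = x :: p, fpath f x p & f (last x p) = x].
Proof.
move=> finj; have := cycle_orbit finj x; rewrite /orbit.
case: (order f x) (order_gt0 f x) => // n _; rewrite trajectS => /=.
rewrite rcons_path => /andP[h /eqP e].
by exists (traject f (f x) n).
Qed.

(** The square has the vertices p, f p, g p and f (g p).  If p and g p are on
    different orbits of f, exchanging its sides between f and g merges these
    orbits into one cycle, and leaves the single orbit of g in one piece, with
    a part of it reversed.  If they are on the same orbit, f and g are already
    Hamiltonian. *)
Lemma switch_dec (T : finType) (f g : T -> T) p :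
  injective f -> injective g -> f (g p) = g (f p) -> p != f p ->
  (forall x, fconnect f x p \/ fconnect f x (g p)) ->
  (forall x, fconnect g x p) ->
  decomposes (fun u v => f u = v \/ g u = v) 2 #|T|.
Proof.
move=> finj ginj fg pf fcon gcon.
have csym := fconnect_sym finj.
case: (boolP (fconnect f p (g p))) => [joined|apart].
  apply: (@dec_union _ _ _ 1 1); first apply: (@cyclic_dec _ f (g p)) => // x.
    by case: (fcon x) => // h; apply: connect_trans h joined.
  exact: (@cyclic_dec _ g p).
have [p1 [e1 path1 last1]] := orbit_path (f p) finj.
have [p2 [e2 path2 last2]] := orbit_path (f (g p)) finj.
have [p0 [e0 path0 last0]] := orbit_path (g p) ginj.
move/finj in last1; move/finj in last2; move/ginj in last0.
have hA : hamiltonian ((f p :: p1) ++ (f (g p) :: p2)).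
  rewrite -e1 -e2 /hamiltonian cat_uniq !orbit_uniq /= andbT; apply/andP; split.
    apply: contra apart => /hasP[x]; rewrite -!fconnect_orbit => h2 h1.
    rewrite (connect_trans (fconnect1 f p)) // (connect_trans h1) // csym.
    exact: connect_trans (fconnect1 _ _) h2.
  apply/forallP => x; rewrite mem_cat -!fconnect_orbit.
  by rewrite -!(same_fconnect1 finj) csym [X in _ || X]csym; apply/orP.
have gall x : x \in g p :: p0.
  by rewrite -e0 -fconnect_orbit -(same_fconnect1 ginj) fconnect_sym.
have hB0 : hamiltonian (g p :: p0).
  by rewrite /hamiltonian -{1}e0 orbit_uniq; apply/forallP.
have nl : f p != last (g p) p0 by rewrite last0 eq_sym.
have [l1 [l2 eB]] := fpath_split path0 (gall (f p)) nl.
have [q1 eq1] : exists q1, rcons l1 (f p) = g p :: q1.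
  by case: l1 eB => [|z l1] /= [<- _]; eexists; reflexivity.
have eB' : g p :: p0 = (g p :: q1) ++ g (f p) :: l2 by rewrite -eq1 cat_rcons.
have [pathq pathl] : fpath g (g p) q1 /\ fpath g (g (f p)) l2.
  by case: eB' path0 => ->; rewrite cat_path /= => /and3P[-> _ ->].
have lq : last (g p) q1 = f p by have := congr1 (last p) eq1; rewrite last_rcons.
have ll : last (g (f p)) l2 = p.
  have := congr1 (last p) eB'; rewrite last_cat /= => <-.
  by rewrite -[in RHS]last0.
rewrite eB' in hB0.
have dA := twist_dec path1 path2 hA; have dB := twist_dec pathq pathl hB0.
rewrite last1 last2 in dA; rewrite lq ll in dB.
apply: dec_sub (dec_union (dec_sym dA) (dec_sym dB)) => u v [<-|<-].
  have [->|n1] := eqVneq u p; first by right; right; constructor 2.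
  have [->|n2] := eqVneq u (g p); first by right; right; constructor 3; rewrite fg.
  by left; left; constructor 1.
have [->|n1] := eqVneq u p; first by left; left; constructor 2.
have [->|n2] := eqVneq u (f p); first by left; right; constructor 3; rewrite -fg.
by right; left; constructor 1.
Qed.

(** * Two Hamiltonian cycles times a third one *)

(** The vertices are pairs (x, t), with x on the first cycle, which is the ring
    of length M, and t on the ring of length N; [sigma] is the successor on the
    second cycle, which contains the edge from w to the origin o.  Each
    layer of the second cycle is cut at that edge, and [zigD] joins all the
    layers, going up alternately above w (even t) and above o (odd t).  The
    vertical edges it takes are replaced in [upA] by the edges between w
    and o.  Apart from this, [upA] goes up and [rightB] goes right, except on the
    diagonal N | x + t, where the directions are exchanged. *)
Section Triple.
Variables (M N : nat) (sigma tau : 'I_M -> 'I_M) (o w : 'I_M).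
Hypothesis N4 : 4 <= N.
Hypothesis evenN : ~~ odd N.
Hypothesis NM : N %| M.
Hypothesis coMN : coprime M N.-1.
Hypothesis o0 : o = 0 :> nat.
Hypothesis odd_w : odd w.
Hypothesis w_neq1 : w != 1 :> nat.
Hypothesis w_neqN1 : ~~ (N %| w.+1).
Hypothesis sigmaK : cancel sigma tau.
Hypothesis tauK : cancel tau sigma.
Hypothesis sigma_w : sigma w = o.
Hypothesis sigma_cyclic : forall v, fconnect sigma v w.
Hypothesis tau_cyclic : forall v, fconnect tau v o.

Let T := ('I_M * 'I_N)%type.

Lemma M_gt0 : 0 < M. Proof. exact: leq_ltn_trans (ltn_ord w). Qed.
Lemma N_gt0 : 0 < N. Proof. by lia. Qed.

(** Coordinates are taken modulo M and N, so that steps are additions. *)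
Definition pt (x t : nat) : T :=
  (Ordinal (ltn_pmod x M_gt0), Ordinal (ltn_pmod t N_gt0)).

Lemma ptE (z : T) : z = pt z.1 z.2.
Proof.
by case: z => x t; congr (_, _); apply: val_inj; rewrite /= modn_small.
Qed.

Lemma pt_eq x t x' t' : x = x' %[mod M] -> t = t' %[mod N] -> pt x t = pt x' t'.
Proof. by move=> ex et; congr (_, _); apply: val_inj. Qed.

Definition diag (z : T) := N %| z.1 + z.2.

Definition upA (z : T) : T :=
  if diag z then (ordS z.1, z.2)
  else if (z.1 == w) && ~~ odd z.2 then (o, z.2)
  else if (z.1 == o) && odd z.2 then (w, z.2)
  else (z.1, ordS z.2).

Definition rightB (z : T) : T :=
  if diag z then (z.1, ordS z.2) else (ordS z.1, z.2).

Definition zigD (z : T) : T :=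
  if odd z.2 then if z.1 == o then (z.1, ordS z.2) else (tau z.1, z.2)
  else if z.1 == w then (z.1, ordS z.2) else (sigma z.1, z.2).

Lemma odd_ordS (t : 'I_N) : odd (ordS t) = ~~ odd t.
Proof. by rewrite /= odd_mod //; apply: negbTE. Qed.

Lemma dvd_ordS1 (x : 'I_M) t : (N %| ordS x + t) = (N %| x.+1 + t).
Proof. by rewrite /= /dvdn -modnDml modn_dvdm // modnDml. Qed.

Lemma dvd_ordS2 x (t : 'I_N) : (N %| x + ordS t) = (N %| x + t.+1).
Proof. by rewrite /= /dvdn modnDmr. Qed.

(** Multiples of N are even; as M and N are even, parities are well defined on
    both rings, which separates most of the cases below. *)
Lemma odd_dvd x : N %| x -> ~~ odd x.
Proof. by move=> h; rewrite -dvdn2; apply: dvdn_trans h; rewrite dvdn2. Qed.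

Lemma pairE A B (a a' : A) (b b' : B) : (a, b) = (a', b') -> a = a' /\ b = b'.
Proof. by move=> e; split; [apply: (congr1 fst e) | apply: (congr1 snd e)]. Qed.

Lemma o_neq_w : (o == w) = false.
Proof. by apply/negbTE; apply: contraTneq odd_w => <-; rewrite o0. Qed.

Lemma rightB_inj : injective rightB.
Proof.
have mixed (x x' : 'I_M) (t t' : 'I_N) :
    N %| x + t -> ~~ (N %| x' + t') -> (x, ordS t) = (ordS x', t') -> False.
  move=> h1 /negP h2 e; have [ex et] := pairE e; apply: h2; move: h1.
  by rewrite ex -et dvd_ordS1 dvd_ordS2 addSnnS.
move=> [x t] [x' t']; rewrite /rightB /diag /=.
case: ifPn => h; case: ifPn => h'.
- by move=> e; have [-> /ordS_inj ->] := pairE e.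
- by move=> e; case: (mixed _ _ _ _ h h' e).
- by move=> e; case: (mixed _ _ _ _ h' h (esym e)).
- by move=> e; have [/ordS_inj -> ->] := pairE e.
Qed.

Lemma evenM : ~~ odd M.
Proof. exact: odd_dvd NM. Qed.

Lemma odd_ordSM (x : 'I_M) : odd (ordS x) = ~~ odd x.
Proof. by rewrite /= odd_mod //; apply/negbTE/evenM. Qed.

Variant upA_spec (x : 'I_M) (t : 'I_N) : T -> Prop :=
| UpRight of N %| x + t : upA_spec x t (ordS x, t)
| UpZig of ~~ (N %| x + t) & x = w & odd t = false : upA_spec x t (o, t)
| UpZag of ~~ (N %| x + t) & x = o & odd t : upA_spec x t (w, t)
| UpUp of ~~ (N %| x + t) & (odd t = false -> x <> w) & (odd t -> x <> o) :
    upA_spec x t (x, ordS t).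

Lemma upAP x t : upA_spec x t (upA (x, t)).
Proof.
rewrite /upA /diag /=; case: ifPn => h; first by constructor.
case: ifPn => [/andP[/eqP hx /negbTE ht]|hw]; first by constructor.
case: ifPn => [/andP[/eqP hx ht]|ho]; first by constructor.
constructor=> // [ht ex|ht ex]; first by rewrite ex ht eqxx in hw.
by rewrite ex ht eqxx in ho.
Qed.

Lemma upA_inj : injective upA.
Proof.
have par (i j : 'I_M) : i = j -> odd i = odd j by move->.
have parN (i j : 'I_N) : i = j -> odd i = odd j by move->.
have oo : odd o = false by rewrite o0.
have mixed (x x' : 'I_M) (t t' : 'I_N) : N %| x + t -> ~~ (N %| x' + t') ->
    (ordS x, t) = (x', ordS t') -> False.
  move=> h1 /negP h2 e; have [ex et] := pairE e; apply: h2; move: h1.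
  by rewrite -ex et dvd_ordS1 dvd_ordS2 addSnnS.
have wrap (x : 'I_M) (t : 'I_N) y : N %| x + t -> (ordS x, t) = (y, t) -> odd y = odd t -> False.
  move=> /odd_dvd; rewrite oddD => h /(congr1 fst) /= /par; rewrite odd_ordSM => <- e.
  by move: h; rewrite -e; case: (odd x).
move=> [x t] [x' t'].
case: upAP => [h|h ex et|h ex et|h hw ho]; case: upAP => [h'|h' ex' et'|h' ex' et'|h' hw' ho'] e;
  have [e1 e2] := pairE e.
- by rewrite (ordS_inj e1) e2.
- by move: h e; rewrite e2 => h e; case: (wrap _ _ _ h e); rewrite oo et'.
- by move: h e; rewrite e2 => h e; case: (wrap _ _ _ h e); rewrite odd_w et'.
- by case: (mixed _ _ _ _ h h' e).
- by move: h' e; rewrite -e2 => h' e; case: (wrap _ _ _ h' (esym e)); rewrite oo et.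
- by rewrite ex ex' e2.
- by have := parN _ _ e2; rewrite et et'.
- by have := parN _ _ e2; rewrite et odd_ordS => /esym/negbFE /ho' [].
- by move: h' e; rewrite -e2 => h' e; case: (wrap _ _ _ h' (esym e)); rewrite odd_w et.
- by have := parN _ _ e2; rewrite et et'.
- by rewrite ex ex' e2.
- by have := parN _ _ e2; rewrite et odd_ordS => /esym/negbTE /hw' [].
- by case: (mixed _ _ _ _ h' h (esym e)).
- by have := parN _ _ e2; rewrite et' odd_ordS => /negbFE /ho [].
- by have := parN _ _ e2; rewrite et' odd_ordS => /negbTE /hw [].
- by rewrite e1 (ordS_inj e2).
Qed.

Lemma zigD_inj : injective zigD.
Proof.
have parN (i j : 'I_N) : i = j -> odd i = odd j by move->.
move=> [x t] [x' t']; rewrite /zigD /=.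
case: ifPn => ht; case: eqP => hx; case: ifPn => ht'; case: eqP => hx' e;
  have [e1 e2] := pairE e; have := parN _ _ e2; rewrite ?odd_ordS ?ht ?ht' ?(negbTE ht) ?(negbTE ht') // => _.
all: try by rewrite e1 (ordS_inj e2).
all: try by rewrite e2 ?(can_inj sigmaK e1) ?(can_inj tauK e1).
all: try by rewrite hx hx' (ordS_inj e2).
- by case: hx'; apply: (can_inj sigmaK); rewrite -e1 hx sigma_w.
- by case: hx; rewrite -sigma_w -hx' -e1 tauK.
- by case: hx'; rewrite -sigma_w -hx e1 tauK.
- by case: hx; apply: (can_inj sigmaK); rewrite e1 hx' sigma_w.
Qed.

Lemma diag_pt x t : diag (pt x t) = (N %| x + t).
Proof. by rewrite /diag /= /dvdn -modnDmr modn_mod -modnDml modn_dvdm // modnDml modnDmr. Qed.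

Lemma odd_pt x t : odd (pt x t).2 = odd t.
Proof. by rewrite /= odd_mod //; apply: negbTE. Qed.

Lemma ordS_pt x t : (ordS (pt x t).1, (pt x t).2) = pt x.+1 t
   /\ ((pt x t).1, ordS (pt x t).2) = pt x t.+1.
Proof.
by split; congr (_, _); apply: val_inj; rewrite /= -addn1 modnDml addn1.
Qed.

Lemma rightB_pt x t : rightB (pt x t) = if N %| x + t then pt x t.+1 else pt x.+1 t.
Proof. by rewrite /rightB diag_pt; have [-> ->] := ordS_pt x t. Qed.

Lemma pt_o t : (pt 0 t).1 = o.
Proof. by apply: val_inj; rewrite /= mod0n o0. Qed.

Lemma pt_w t : (pt w t).1 = w.
Proof. by apply: val_inj; rewrite /= modn_small. Qed.

Lemma dvd_complement a : exists2 j, j < N & N %| a + j.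
Proof.
(* a + (N - 1) a is a multiple of N. *)
exists ((N.-1 * a) %% N); first by rewrite ltn_mod N_gt0.
by rewrite /dvdn modnDmr -mulSn prednK ?N_gt0 // modnMr.
Qed.

(** From one diagonal to the next, [rightB] moves by (N - 1, 1), and N - 1 is
    invertible modulo M. *)
Lemma rightB_cyclic z : fconnect rightB z (pt 0 2).
Proof.
have cB := fconnect_sym rightB_inj.
have row j x t : j < N -> N %| x + t + j -> fconnect rightB (pt x t) (pt (x + j) t.+1).
  elim: j x => [|j IH] x lj h.
    by rewrite !addn0 in h *; have := fconnect1 rightB (pt x t); rewrite rightB_pt h.
  have nh : ~~ (N %| x + t).
    by apply: contraTN h => h; rewrite dvdn_addr // gtnNdvd.
  apply: (connect_trans (fconnect1 rightB _)); rewrite rightB_pt (negbTE nh) addnS -addSn.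
  by apply: IH; rewrite ?(ltnW lj) // !addSn -addnS.
have stairs x t i : N %| x + t + N.-1 ->
    fconnect rightB (pt x t) (pt (x + i * N.-1) (t + i)).
  move=> h; elim: i => [|i IH]; first by rewrite !addn0.
  apply: (connect_trans IH); rewrite mulSn addnS.
  have -> : x + (N.-1 + i * N.-1) = x + i * N.-1 + N.-1 by lia.
  apply: row; first by rewrite ltn_predL N_gt0.
  have -> : x + i * N.-1 + (t + i) + N.-1 = x + t + N.-1 + i * N.
    by rewrite -[N in RHS]prednK ?N_gt0 // mulnS; lia.
  by rewrite dvdn_add // dvdn_mull.
have home y : fconnect rightB y (pt 0 1).
  rewrite (ptE y); move: (y.1 : nat) (y.2 : nat) => x0 t0.
  have [j lj hj] := dvd_complement (x0 + t0).
  apply: (connect_trans (row _ _ _ lj hj)).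
  have h : N %| x0 + j + t0.+1 + N.-1.
    have -> : x0 + j + t0.+1 + N.-1 = x0 + t0 + j + N by have := N_gt0; lia.
    by rewrite dvdn_add.
  move: (x0 + j) t0.+1 h => x t h.
  have [i _ hi] := Bezoutl N.-1 M_gt0.
  have hx : M %| x + i * x * N.-1.
    by move: hi; rewrite (eqP coMN) => hi; rewrite mulnAC -mulSn -add1n dvdn_mulr.
  apply: (connect_trans (stairs _ _ (i * x) h)).
  rewrite (pt_eq (x' := 0) (t' := 1)) //; first by rewrite mod0n; apply/eqP.
  have hN := dvdn_trans NM hx.
  have : N %| (x + i * x * N.-1) + (t + i * x + N.-1).
    have -> : x + i * x * N.-1 + (t + i * x + N.-1) = x + t + N.-1 + i * x * N.
      have -> : i * x * N = i * x + i * x * N.-1 by rewrite -mulnS prednK ?N_gt0.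
      by move: (i * x) (i * x * N.-1) => ix ixN; clear; lia.
    by rewrite dvdn_add // dvdn_mull.
  rewrite dvdn_addr // => hd.
  by apply/eqP; rewrite -(eqn_modDr N.-1) add1n prednK ?N_gt0 // modnn.
by apply: (connect_trans (home z)); rewrite cB.
Qed.

(** The two corners of the switched square; every orbit of [upA] contains one
    of them. *)
Let good z := fconnect upA z (pt 0 2) \/ fconnect upA z (pt 1 2).

Lemma good_step z : good (upA z) -> good z.
Proof. by case=> h; [left|right]; apply: connect_trans (fconnect1 upA z) h. Qed.

Lemma upA_pt x t : upA (pt x t) =
  if N %| x + t then pt x.+1 t
  else if ((pt x t).1 == w) && ~~ odd t then pt 0 t
  else if ((pt x t).1 == o) && odd t then pt w t
  else pt x t.+1.
Proof.
rewrite /upA diag_pt odd_pt; have [-> ->] := ordS_pt x t.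
by rewrite -(pt_o t) -{2}(pt_w t).
Qed.

(** In an ordinary column, [upA] goes up to the diagonal and then enters the next
    column. *)
Lemma good_column j x t : (pt x t).1 != w -> (pt x t).1 != o ->
  N %| x + t + j -> good (pt x.+1 (t + j)) -> good (pt x t).
Proof.
move=> nw no; elim: j t nw no => [|j IH] t nw no h g; apply: good_step; rewrite upA_pt.
  by rewrite !addn0 in h g; rewrite h.
case: ifPn => h'.
  have h2 : N %| j.+1 by move: h; rewrite dvdn_addr.
  by rewrite (pt_eq (x' := x.+1) (t' := t + j.+1)) // -modnDmr (eqP h2) addn0.
rewrite (negbTE nw) (negbTE no) /=; apply: IH => //; last by rewrite addSnnS.
by rewrite addnS addSn -addnS.
Qed.

Lemma good_base1 : good (pt 1 0).
Proof.
have p1w t : (pt 1 t).1 != w.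
  by apply: contra w_neq1 => /eqP <-; rewrite /= modn_small //; have := dvdn_leq M_gt0 NM; lia.
have p1o t : (pt 1 t).1 != o.
  apply/eqP => /(congr1 val); rewrite /= o0 modn_small //; have := dvdn_leq M_gt0 NM; lia.
apply: good_step; rewrite upA_pt gtnNdvd //; last lia.
rewrite (negbTE (p1w _)) (negbTE (p1o _)) /=.
apply: good_step; rewrite upA_pt gtnNdvd //; last lia.
by rewrite (negbTE (p1w _)) (negbTE (p1o _)) /=; right.
Qed.

Lemma good_base0 : good (pt 0 1).
Proof.
apply: good_step; rewrite upA_pt gtnNdvd //; last lia.
rewrite pt_o o_neq_w eqxx /=.
apply: good_step; rewrite upA_pt addn1 (negbTE w_neqN1) pt_w eqxx /= eq_sym o_neq_w /=.
apply: good_step; rewrite upA_pt pt_w eqxx /=.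
have /negbTE -> : ~~ (N %| w + 2) by apply: contraL odd_w => /odd_dvd; rewrite oddD addbF.
by left.
Qed.

Lemma good_right i x t : x + i = M -> w < x -> N %| x.-1 + t -> good (pt x t).
Proof.
elim: i x t => [|i IH] x t ex lx h.
  rewrite addn0 in ex; rewrite (pt_eq (x' := 0) (t' := 1)); first exact: good_base0.
    by rewrite ex modnn mod0n.
  have hx : N %| x by rewrite ex.
  have : N %| x + (N.-1 + t).
    have -> : x + (N.-1 + t) = x.-1 + t + N by have := N_gt0; lia.
    by rewrite dvdn_add.
  rewrite dvdn_addr // => hd; apply/eqP.
  by rewrite -(eqn_modDl N.-1) addn1 prednK ?N_gt0 // modnn.
have [j lj hj] := dvd_complement (x + t).
have xM : x < M by lia.
apply: (@good_column j) => //.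
- by apply/eqP => /(congr1 val) /=; rewrite modn_small //; lia.
- by apply/eqP => /(congr1 val) /=; rewrite o0 modn_small //; lia.
apply: IH; [lia|lia|by rewrite /= addnA].
Qed.

Lemma good_exit t : N %| w + t -> good (pt w.+1 t).
Proof. by move=> h; apply: (@good_right (M - w.+1)) => //; rewrite subnKC. Qed.

(** Above o and w, [upA] zigzags upwards until it meets the diagonal in one of the
    two columns, where it leaves to the right. *)
Lemma good_w_odd j t : odd t -> N %| w + t + j.*2 -> good (pt w t).
Proof.
elim: j t => [|j IH] t ot h; apply: good_step; rewrite upA_pt.
  by rewrite addn0 in h; rewrite h; apply: good_exit.
case: ifPn => h1; first exact: good_exit.
rewrite pt_w eqxx ot /= eq_sym o_neq_w /=.
apply: good_step; rewrite upA_pt pt_w eqxx /= ot /=.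
have /negbTE -> : ~~ (N %| w + t.+1).
  by apply/negP => /odd_dvd; rewrite oddD odd_w /= ot.
apply: good_step; rewrite upA_pt add0n pt_o o_neq_w /= ot andbF.
case: ifPn => h2.
  by rewrite (pt_eq (x' := 1) (t' := 0)) ?mod0n //; [exact: good_base1 | apply/eqP].
apply: good_step; rewrite upA_pt add0n pt_o o_neq_w eqxx /= !negbK ot.
have /negbTE -> : ~~ (N %| t.+2) by apply/negP => /odd_dvd; rewrite /= negbK ot.
apply: IH; first by rewrite /= negbK.
by move: h; rewrite doubleS !addnS !addSn.
Qed.

Lemma good_w_o t : good (pt w t) /\ good (pt 0 t).
Proof.
have gw u : odd u -> good (pt w u).
  move=> ou; apply: (@good_w_odd ((N.-1 * (w + u))./2)) => //.
  rewrite halfK.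
  have -> : odd (N.-1 * (w + u)) = false by rewrite oddM oddD odd_w ou andbF.
  by rewrite subn0 -mulSn prednK ?N_gt0 // dvdn_mulr.
have go_odd u : odd u -> good (pt 0 u).
  move=> ou; apply: good_step; rewrite upA_pt add0n pt_o eqxx o_neq_w ou /=.
  by rewrite (negbTE (contraL (@odd_dvd u) _)) ?ou //; apply: gw.
have go u : good (pt 0 u).
  case: (boolP (odd u)) => [|eu]; first exact: go_odd.
  apply: good_step; rewrite upA_pt add0n pt_o eqxx o_neq_w (negbTE eu) /=.
  case: ifP => h; last by apply: go_odd; rewrite /= eu.
  by rewrite (pt_eq (x' := 1) (t' := 0)) ?mod0n //; [exact: good_base1 | apply/eqP].
split=> //; case: (boolP (odd t)) => [|et]; first exact: gw.
apply: good_step; rewrite upA_pt pt_w eqxx et /=.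
have /negbTE -> : ~~ (N %| w + t) by apply: contraL odd_w => /odd_dvd; rewrite oddD (negbTE et) addbF.
exact: go.
Qed.

Lemma good_left i x t : 0 < x -> x + i = w -> good (pt x t).
Proof.
elim: i x t => [|i IH] x t x0 ex.
  by rewrite addn0 in ex; rewrite ex; case: (good_w_o t).
have [j lj hj] := dvd_complement (x + t); have wM := ltn_ord w.
apply: (@good_column j) => //.
- by apply/eqP => /(congr1 val) /=; rewrite modn_small //; lia.
- by apply/eqP => /(congr1 val) /=; rewrite o0 modn_small //; lia.
by apply: IH => //; lia.
Qed.

Lemma good_all z : good z.
Proof.
rewrite (ptE z); move: (ltn_ord z.1) (z.2 : nat); move: (z.1 : nat) => x lx t.
case: (posnP x) => [->|x0]; first by case: (good_w_o t).
case: (ltngtP x w) => [lt_x|lt_x|->]; last by case: (good_w_o t).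
  by apply: (@good_left (w - x)) => //; rewrite subnKC // ltnW.
have [j lj hj] := dvd_complement (x + t).
apply: (@good_column j) => //.
- by apply/eqP => /(congr1 val) /=; rewrite modn_small //; lia.
- by apply/eqP => /(congr1 val) /=; rewrite o0 modn_small //; lia.
by apply: (@good_right (M - x.+1)); rewrite ?subnKC //= ?addnA // ltnW.
Qed.

(** Each layer is run through along the second cycle, forwards for even t and
    backwards for odd t, before going up. *)
Lemma zigD_cyclic z : fconnect zigD z (o, Ordinal N_gt0).
Proof.
have stepD y : fconnect zigD y (zigD y) by exact: fconnect1.
have to_w v t : ~~ odd (t : 'I_N) -> fconnect zigD (v, t) (w, t).
  move=> et; have /iter_findex := sigma_cyclic v; move: (findex _ _ _) => i.
  elim: i v => [|i IH] v; first by move=> /= ->.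
  have [-> //|nw] := eqVneq v w; rewrite iterSr => /IH; apply: connect_trans.
  by have := stepD (v, t); rewrite /zigD /= (negbTE et) (negbTE nw).
have to_o v t : odd (t : 'I_N) -> fconnect zigD (v, t) (o, t).
  move=> ot; have /iter_findex := tau_cyclic v; move: (findex _ _ _) => i.
  elim: i v => [|i IH] v; first by move=> /= ->.
  have [-> //|no] := eqVneq v o; rewrite iterSr => /IH; apply: connect_trans.
  by have := stepD (v, t); rewrite /zigD /= ot (negbTE no).
have up_o v t : odd (t : 'I_N) -> fconnect zigD (v, t) (o, ordS t).
  move=> ot; apply: connect_trans (to_o v t ot) _.
  by have := stepD (o, t); rewrite /zigD /= ot eqxx.
have up2 v t : ~~ odd (t : 'I_N) -> fconnect zigD (v, t) (o, ordS (ordS t)).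
  move=> et; apply: connect_trans (to_w v t et) _.
  apply: (@connect_trans _ _ (w, ordS t)); last by apply: up_o; rewrite odd_ordS.
  by have := stepD (w, t); rewrite /zigD /= (negbTE et) eqxx.
have base i v t : ~~ odd (t : 'I_N) -> t + i.*2.+2 = N -> fconnect zigD (v, t) (o, Ordinal N_gt0).
  elim: i v t => [|i IH] v t et e; apply: connect_trans (up2 v t et) _.
    suff -> : ordS (ordS t) = Ordinal N_gt0 by [].
    apply: val_inj; rewrite /= -addn1 modnDml addn1.
    by have -> : t.+2 = N; [lia | rewrite modnn].
  apply: IH; first by rewrite !odd_ordS negbK.
  by rewrite /= -addn1 modnDml addn1 modn_small; lia.
have even_case v (t : 'I_N) : ~~ odd t -> fconnect zigD (v, t) (o, Ordinal N_gt0).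
  move=> et; apply: (base ((N - t)./2.-1)) => //.
  have := ltn_ord t; move: evenN et; lia.
case: z => v t; case: (boolP (odd t)) => ot; last exact: even_case.
by apply: connect_trans (up_o v t ot) _; apply: even_case; rewrite odd_ordS ot.
Qed.

Lemma dec_triple_ord :
  decomposes (cart (fun u v : 'I_M => ordS u = v \/ sigma u = v) (@ring_step N)) 3 (M * N).
Proof.
have card_T : #|{: T}| = M * N by rewrite card_prod !card_ord.
have up12 : upA (pt 0 2) = pt 0 3.
  by rewrite upA_pt gtnNdvd //; [rewrite pt_o o_neq_w eqxx | lia].
have right12 : rightB (pt 0 2) = pt 1 2 by rewrite rightB_pt gtnNdvd //; lia.
have dAB : decomposes (fun u v => upA u = v \/ rightB u = v) 2 (M * N).
  rewrite -card_T; apply: (switch_dec (p := pt 0 2)) upA_inj rightB_inj _ _ _ rightB_cyclic.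
  - rewrite up12 right12 rightB_pt upA_pt.
    rewrite !gtnNdvd //; try lia.
    have -> : (pt 1 2).1 == w = false.
      apply/negP => /eqP /(congr1 val) /=; rewrite modn_small; last by have := dvdn_leq M_gt0 NM; lia.
      by move/eqP; rewrite eq_sym (negbTE w_neq1).
    by rewrite andbF.
  - rewrite up12; apply/eqP => /(congr1 snd) /(congr1 val) /=.
    by rewrite !modn_small //; lia.
  - by rewrite right12; apply: good_all.
have dD : decomposes (fun u v => zigD u = v) 1 (M * N).
  by rewrite -card_T; apply: cyclic_dec zigD_inj zigD_cyclic.
apply: dec_sub (dec_union (dec_sym dAB) (dec_sym dD)) => -[x t] [x' t'] [[/= h <-]|[/= <- <-]]; last first.
  case: (boolP (diag (x, t))) => hd; first by left; left; right; rewrite /rightB hd.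
  rewrite /zigD /=; case: (boolP (odd t)) => ot.
    case: eqP => [->|hx]; first by right; left.
    by left; left; left; rewrite /upA (negbTE hd) /= ot andbF; case: eqP.
  case: eqP => [->|hx]; first by right; left.
  by left; left; left; rewrite /upA (negbTE hd) /= (negbTE ot) andbF; case: eqP.
case: h => <-.
  case: (boolP (diag (x, t))) => hd; first by left; left; left; rewrite /upA hd.
  by left; left; right; rewrite /rightB (negbTE hd).
case: (boolP (odd t)) => ot.
  have [xo|nxo] := eqVneq (sigma x) o.
    have -> : x = w by apply: (can_inj sigmaK); rewrite xo.
    left; right; left; rewrite sigma_w /upA /diag /= o0 add0n.
    have /negbTE -> : ~~ (N %| t) by apply: contraL ot => /odd_dvd.
    by rewrite o_neq_w eqxx ot.
  by right; right; rewrite /zigD /= ot (negbTE nxo) sigmaK.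
have [->|nxw] := eqVneq x w.
  left; left; left; rewrite sigma_w /upA /diag /=.
  have /negbTE -> : ~~ (N %| w + t).
    by apply: contraL odd_w => /odd_dvd; rewrite oddD (negbTE ot) addbF.
  by rewrite eqxx ot.
by right; left; rewrite /zigD /= (negbTE ot) (negbTE nxw).
Qed.

End Triple.

Lemma ham_connect (T : finType) (c : seq T) x y :
  hamiltonian c -> fconnect (next c) x y.
Proof.
move=> hc; rewrite (fconnect_cycle (cycle_next (ham_uniq hc)) (ham_mem hc x)).
exact: ham_mem.
Qed.

Lemma fconnect_conj (A B : finType) (h : A -> A) (f : A -> B) (g : B -> A) x y :
  cancel f g -> fconnect h x y -> fconnect (f \o h \o g) (f x) (f y).
Proof.
move=> fK /iter_findex <-; move: (findex _ _ _) => i.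
suff -> : f (iter i h x) = iter i (f \o h \o g) (f x) by apply: fconnect_iter.
by elim: i => //= i <-; rewrite fK.
Qed.

Lemma ham_rotr (T : finType) (c : seq T) n : hamiltonian c -> hamiltonian (rotr n c).
Proof. exact: ham_rot. Qed.

Section TripleHam.
Variables (T1 T2 : finType) (c1 c2 : seq T2) (c : seq T1) (col : T2 -> bool).
Variables (p q : nat) (u w : T2).
Hypotheses (h1 : hamiltonian c1) (h2 : hamiltonian c2) (hc : hamiltonian c).
Hypotheses (cardT2 : #|T2| = 2 ^ p) (cardT1 : #|T1| = 2 ^ q) (q2 : 2 <= q <= p).
Hypothesis col1 : forall x, col (next c1 x) = ~~ col x.
Hypothesis col2 : forall x, col (next c2 x) = ~~ col x.
Hypothesis wu : next c2 w = u.
Hypothesis uw : next c1 u != w.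

(** The edge from w to u of the second cycle joins vertices of different colours,
    so w has odd position on the first cycle when u has position 0. *)
Lemma dec_triple_at : index u c1 = 0 -> ~~ (2 ^ q %| (index w c1).+1) ->
  decomposes (cart (fun x y => follows c1 x y \/ follows c2 x y) (follows c)) 3 (2 ^ p * 2 ^ q).
Proof.
case/andP: q2 => qge2 qp iu iw.
have [f [[g fK gK] fS fnth fidx]] := ham_iso h1 u cardT2.
have [t0 _] : exists t, t \in T1 by apply/card_gt0P; rewrite cardT1 expn_gt0.
have [f' [f'bij f'S _ _]] := ham_iso hc t0 cardT1.
pose sigma := f \o next c2 \o g; pose tau := f \o next (rev c2) \o g.
have nextK : cancel (next c2) (prev c2) by apply/prev_next/ham_uniq.
have prevK : cancel (prev c2) (next c2) by apply/next_prev/ham_uniq.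
have nrev : next (rev c2) =1 prev c2 by apply/next_rev/ham_uniq.
have par x : odd (f x) = col x (+) col u.
  have u0 : nth u c1 0 = u by rewrite -iu nth_index // ham_mem.
  have ex : iter (f x) (next c1) u = x.
    rewrite -{1}u0 iter_next_nth // ?ham_size ?cardT2 ?expn_gt0 //.
    by rewrite add0n modn_small // fnth.
  rewrite -{2}ex; elim: (nat_of_ord _) => [|i IH] /=; first by rewrite addbb.
  by rewrite col1 addNb IH.
have d : decomposes (cart (fun x y : 'I_(2 ^ p) => ordS x = y \/ sigma x = y) (@ring_step (2 ^ q))) 3
    (2 ^ p * 2 ^ q).
  have q1 : 0 < q by apply: leq_trans qge2.
  apply: (@dec_triple_ord _ _ sigma tau (f u) (f w)).
  - by rewrite -[4]/(2 ^ 2) leq_exp2l.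
  - by case: q q1 => // k _; rewrite expnS oddM.
  - by rewrite dvdn_exp2l.
  - apply: coprimeXl; rewrite coprime2n; case: q q1 => // k _.
    by rewrite -subn1 oddB ?expn_gt0 // expnS oddM.
  - by rewrite fidx.
  - by rewrite par -wu col2; case: col.
  - apply: contra uw => /eqP w1; apply/eqP/(can_inj fK)/val_inj.
    rewrite -(fS u _ (erefl _)) /= fidx iu w1 modn_small //.
    by rewrite -{1}(expn0 2) ltn_exp2l // (leq_trans q1 qp).
  - by rewrite fidx.
  - by move=> x; rewrite /sigma /tau /= fK nrev nextK gK.
  - by move=> x; rewrite /sigma /tau /= fK nrev prevK gK.
  - by rewrite /sigma /= fK wu.
  - by move=> v; rewrite -(gK v); apply: fconnect_conj fK _; apply: ham_connect.
  - by move=> v; rewrite -(gK v); apply: fconnect_conj fK _; apply/ham_connect/ham_rev.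
apply: (dec_iso (f := fun z => (f z.1, f' z.2))) d.
  case: f'bij => g' f'K g'K.
  by exists (fun z => (g z.1, g' z.2)) => -[x y] /=; rewrite ?fK ?f'K ?gK ?g'K.
move=> [x y] [x' y'] [[/= [h|h] ->]|[/= -> h]].
- by left; split=> //; left; apply: fS.
- by left; split=> //; right; rewrite /sigma /= fK h.
- by right; split=> //; apply: f'S.
Qed.

End TripleHam.

(** The condition on the position of w fails only if it is -1 modulo 2^q;
    reversing the first cycle then makes it 1. *)
Lemma dec_triple (T1 T2 : finType) (c1 c2 : seq T2) (c : seq T1) (col : T2 -> bool)
    (p q : nat) (u w : T2) :
  hamiltonian c1 -> hamiltonian c2 -> hamiltonian c ->
  #|T2| = 2 ^ p -> #|T1| = 2 ^ q -> 2 <= q <= p ->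
  (forall x, col (next c1 x) = ~~ col x) ->
  (forall x, col (next c2 x) = ~~ col x) ->
  next c2 w = u -> next c1 u != w -> next c1 w != u ->
  decomposes (cart (fun x y => follows c1 x y \/ follows c2 x y) (follows c)) 3 (2 ^ p * 2 ^ q).
Proof.
move=> h1 h2 hc cT2 cT1 q2 col1 col2 wu uw wu1.
have [i c1' rc1] := rot_to (ham_mem h1 u).
have h1' : hamiltonian (u :: c1') by rewrite -rc1; apply: ham_rot.
have n1' x : next (u :: c1') x = next c1 x by rewrite -rc1 next_rot // ham_uniq.
have i0 (l : seq T2) : index u (u :: l) = 0 by rewrite /= eqxx.
case: (boolP (2 ^ q %| (index w (u :: c1')).+1)) => hw; last first.
  have := @dec_triple_at _ _ (u :: c1') c2 c col p q u w h1' h2 hc cT2 cT1 q2.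
  rewrite n1' => /(_ _ col2 wu uw (i0 _) hw) d; apply: dec_sub (d _).
    move=> [x y] [x' y'] [[/= [h|h] ->]|[/= -> h]]; [left|left|right]; split=> //; last by right.
    by left; rewrite /follows n1'.
  by move=> x; rewrite n1'.
pose c1r := u :: rev c1'.
have rc1r : c1r = rotr 1 (rev (u :: c1')).
  by rewrite rev_cons rotr1_rcons.
have h1r : hamiltonian c1r by rewrite rc1r; apply/ham_rotr/ham_rev.
have u1 := ham_uniq h1'.
have n1r x : next c1r x = prev c1 x.
  rewrite rc1r next_rotr ?rev_uniq // next_rev // -rc1 prev_rot //.
  exact: ham_uniq h1.
have prevK : cancel (prev c1) (next c1) by apply/next_prev/ham_uniq.
have nextK : cancel (next c1) (prev c1) by apply/prev_next/ham_uniq.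
have wnu : w != u by apply/eqP => e; have := col2 w; rewrite wu e; case: (col u).
have sz : size (u :: c1') = 2 ^ p by rewrite ham_size.
have Q4 : 4 <= 2 ^ q by rewrite -[4]/(2 ^ 2) leq_exp2l //; case/andP: q2.
have QM : 2 ^ q %| 2 ^ p by rewrite dvdn_exp2l //; case/andP: q2.
have hr : ~~ (2 ^ q %| (index w c1r).+1).
  have wc : w \in c1' by have := ham_mem h1' w; rewrite inE (negbTE wnu).
  have ltk : index w c1' < size c1' by rewrite index_mem.
  have ik : index w (u :: c1') = (index w c1').+1 by rewrite /= eq_sym (negbTE wnu).
  have ir : index w c1r = 2 ^ p - index w (u :: c1').
    rewrite ik -sz [size _]/=; set k := index w c1' in ltk *.
    have e : (size c1').+1 - k.+1 = (size c1' - k.+1).+1 by rewrite subSS subnSK.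
    have ew : nth u c1r ((size c1').+1 - k.+1) = w.
      rewrite e /= nth_rev; last by rewrite ltn_subrL (leq_ltn_trans _ ltk).
      have -> : size c1' - (size c1' - k.+1).+1 = k by rewrite subnSK // subKn // ltnW.
      exact: nth_index.
    have := @index_uniq _ u ((size c1').+1 - k.+1) c1r; rewrite ew; apply; last exact: ham_uniq.
    by rewrite /= size_rev subSS ltnS leq_subr.
  rewrite ir; apply/negP => hd; have := dvdn_add hw hd.
  have -> : (index w (u :: c1')).+1 + (2 ^ p - index w (u :: c1')).+1 = 2 ^ p + 2.
    rewrite addSn addnS subnKC ?addn2 // ltnW //.
    by rewrite -sz index_mem (ham_mem h1').
  rewrite dvdn_addr // => /dvdn_leq le2.
  by have := leq_trans Q4 (le2 isT).
have := @dec_triple_at _ _ c1r c2 c col p q u w h1r h2 hc cT2 cT1 q2.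
rewrite n1r => /(_ _ col2 wu _ (i0 _) hr) d.
apply: dec_sub (dec_sym (d _ _)).
- move=> [x y] [x' y'] [[/= [h|h] ->]|[/= -> h]].
  + by right; left; split=> //; left; rewrite /follows n1r -h nextK.
  + by left; left; split=> //; right.
  + by left; right.
- by move=> x; rewrite n1r -[in RHS](prevK x) col1 negbK.
- by apply: contra wu1 => /eqP <-; rewrite prevK.
Qed.

(** * Hamiltonian decomposition of the cube *)

(** Weaving with every vertex of the first cycle chosen, and a rise of 2. *)
Lemma dec_pair (T1 T2 : finType) (c1 : seq T1) (c2 : seq T2) p q :
  hamiltonian c1 -> hamiltonian c2 -> #|T1| = 2 ^ p -> #|T2| = 2 ^ q ->
  0 < p -> 0 < q ->
  decomposes (cart (follows c1) (follows c2)) 2 (2 ^ p * 2 ^ q).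
Proof.
move=> h1 h2 cT1 cT2 p0 q0.
have [t0 _] : exists t, t \in T2 by apply/card_gt0P; rewrite cT2 expn_gt0.
have [f [[g fK gK] fS _ _]] := ham_iso h2 t0 cT2.
have odd2 k : 0 < k -> ~~ odd (2 ^ k) by case: k => // k _; rewrite expnS oddM.
have D2 k : 0 < k -> (2 ^ k.-1).*2 = 2 ^ k by move=> k0; rewrite -muln2 -expnSr prednK.
have P2 : 2 <= 2 ^ p by rewrite -{1}(expn1 2) leq_exp2l.
have EP : 2 ^ p - (2 ^ p.-1 - 1).*2 = 2 by rewrite doubleB D2 // subKn.
have := @dec_weave_cycle T1 (follows c1) (2 ^ p) 1 (2 ^ q) (2 ^ p.-1 - 1) (2 ^ q.-1)
  isT _ (odd2 _ q0) _ (odd2 _ p0).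
rewrite muln1 EP doubleB D2 // leq_subr expn_gt0 -{1}(expn0 2) ltn_exp2l //.
have -> : (2 ^ p + 2 ^ p) * 2 ^ q.-1 = 2 ^ p * 2 ^ q.
  by rewrite addnn -muln2 -mulnA -expnS prednK.
move=> /(_ q0 isT isT); case=> [t||X HX].
- by rewrite -{1}(prednK q0) expnS dvdn_pmul2l.
- by rewrite -cT1; apply: ham_dec.
apply: (dec_iso (f := fun z => (z.1, f z.2)) (e := cart (follows c1) (@ring_step (2 ^ q)))).
- by exists (fun z => (z.1, g z.2)) => -[x y] /=; rewrite ?fK ?gK.
- by move=> [x y] [x' y'] [[/= h ->]|[/= -> h]]; [left|right; split=> //; apply: fS].
by exists X.
Qed.

Lemma dec_pairs (T1 T2 : finType) (cs1 : seq (seq T1)) (cs2 : seq (seq T2)) p q :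
  all (@hamiltonian T1) cs1 -> all (@hamiltonian T2) cs2 ->
  #|T1| = 2 ^ p -> #|T2| = 2 ^ q -> 0 < p -> 0 < q -> size cs1 = size cs2 ->
  decomposes (cart (union_ham cs1) (union_ham cs2)) (size cs1 + size cs2) (2 ^ p * 2 ^ q).
Proof.
move=> + + cT1 cT2 p0 q0.
elim: cs1 cs2 => [|c1 cs1 IH] [|c2 cs2] //= => [_ _ _|/andP[h1 hs1] /andP[h2 hs2] [sz]].
  apply: dec_sub (dec0 _ _) => -[x y] [x' y'].
  by case=> -[]; [case=> ? | move=> _ [?]]; rewrite in_nil.
have d2 := dec_sym (dec_pair h1 h2 cT1 cT2 p0 q0).
have -> : (size cs1).+1 + (size cs2).+1 = 2 + (size cs1 + size cs2) by rewrite addSn addnS.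
apply: dec_sub (dec_union d2 (IH _ hs1 hs2 sz)) => -[x y] [x' y'] [[/= h ->]|[/= -> h]].
  case: h => c; rewrite inE => /predU1P[->|cin] h; last by right; left; split=> //; exists c.
  by left; case: h => h; [left|right]; left.
case: h => c; rewrite inE => /predU1P[->|cin] h; last by right; right; split=> //; exists c.
by left; case: h => h; [left|right]; right.
Qed.

Definition flip_step (a b : bool) : Prop := a = ~~ b.

Section Cube.
Variable I : finType.
Notation cube := {ffun I -> bool}.

Definition flip (x : cube) (i : I) : cube :=
  [ffun j => if j == i then ~~ x j else x j].

Definition colour (x : cube) := odd (\sum_i x i).

Lemma flip_inj x : injective (flip x).
Proof.
move=> i j /ffunP /(_ i); rewrite !ffunE eqxx; case: eqP => // _.
by case: (x i).
Qed.

Lemma flip_edge x i : gpower flip_step x (flip x i).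
Proof.
exists i; rewrite ffunE eqxx /flip_step negbK; split=> // j nj.
by rewrite ffunE (negbTE nj).
Qed.

Lemma colour_flip x i : colour (flip x i) = ~~ colour x.
Proof.
rewrite /colour [in LHS](bigD1 i) //= [in RHS](bigD1 i) //= !oddD ffunE eqxx.
rewrite (eq_bigr (fun j => x j : nat)); last by move=> j /negbTE nj; rewrite ffunE nj.
by rewrite -addNb; case: (x i).
Qed.

(** The 2r successors and predecessors of x on r Hamiltonian cycles cover its 2r
    neighbours, hence are distinct and are all neighbours. *)
Lemma ham_cube_neighbours (cs : seq (seq cube)) x :
  #|I| = size cs + size cs -> all (@hamiltonian _) cs ->
  (forall u v : cube, gpower flip_step u v -> union_ham cs u v) ->
  let nb := [seq next c x | c <- cs] ++ [seq prev c x | c <- cs] in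
  uniq nb /\ forall y, y \in nb -> exists i, y = flip x i.
Proof.
move=> cI hs cov nb; pose fl := [seq flip x i | i <- enum I].
have ufl : uniq fl by rewrite map_inj_uniq ?enum_uniq //; apply: flip_inj.
have sub : {subset fl <= nb}.
  move=> _ /mapP[i _ ->]; have [c cin h] := cov _ _ (flip_edge x i).
  rewrite mem_cat; case: h => h; apply/orP; [left|right]; apply/mapP; exists c => //.
  by rewrite -[in RHS]h prev_next //; apply/ham_uniq/(allP hs).
have sz : size nb <= size fl by rewrite /fl size_map -cardE cI /nb size_cat !size_map.
split; first exact: leq_size_uniq ufl sub sz.
have [_ eq_nb] := uniq_min_size ufl sub sz.
by move=> y; rewrite -eq_nb => /mapP[i _ ->]; exists i.
Qed.

End Cube.

(** The square Q_2 is the orbit of the map (a, b) to (b, not a). *)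
Lemma dec_square (I : finType) : #|I| = 2 -> decomposes (gpower (I := I) flip_step) 1 4.
Proof.
move=> cI; apply: (@dec_pw_reindex (unit + unit)%type); first by rewrite card_sum card_unit.
apply: dec_pw_sum; pose f (z : bool * bool) := (z.2, ~~ z.1).
have finj : injective f by move=> [a b] [a' b'] [-> /negb_inj ->].
have fz x : fconnect f x (false, false).
  case: x => -[] [].
  - exact: (fconnect_iter f 2 (true, true)).
  - exact: (fconnect_iter f 1 (true, false)).
  - exact: (fconnect_iter f 3 (false, true)).
  - exact: connect0.
have := cyclic_dec finj fz; rewrite card_prod card_bool => /dec_sym d.
apply: (dec_iso (f := fun z : {ffun unit -> bool} * {ffun unit -> bool} => (z.1 tt, z.2 tt))) d.
  exists (fun z : bool * bool => ([ffun => z.1], [ffun => z.2])) => -[x y].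
    by congr (_, _); apply/ffunP => -[]; rewrite ffunE.
  by rewrite !ffunE.
move=> [x y] [x' y'] [[/= [[] [h _]] <-]|[/= <- [[] [h _]]]]; rewrite /f /= h.
  by case: (x' tt); case: (y tt); [left|right|right|left].
by case: (x tt); case: (y' tt); [right|left|left|right].
Qed.

(** For n = 2m + 1, the cubes with 2(m + 1) and 2m coordinates have m + 1 and m
    Hamiltonian cycles: two cycles of the first are combined with one of the
    second, and the others are paired. *)
Lemma cube_hamiltonian n (I : finType) :
  0 < n -> #|I| = n + n -> decomposes (gpower (I := I) flip_step) n (2 ^ (n + n)).
Proof.
elim/ltn_ind: n I => n IH I n0 cI.
have [n1|n1] := eqVneq n 1; first by rewrite n1 in cI *; apply: dec_square.
have split k : 0 < k < n -> exists cs : seq (seq {ffun 'I_(k + k) -> bool}),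
    [/\ size cs = k, all (@hamiltonian _) cs
      & forall u v, gpower flip_step u v -> union_ham cs u v].
  case/andP=> k0 kn; apply: (@dec_ham_split _ _ _ [ffun=> false]).
  by rewrite card_ffun card_bool card_ord; apply: IH => //; rewrite card_ord.
have cT k : #|{: {ffun 'I_(k + k) -> bool}}| = 2 ^ (k + k).
  by rewrite card_ffun card_bool card_ord.
pose m := n./2; have m0 : 0 < m by rewrite /m; lia.
have [|cs1 [sz1 hs1 cov1]] := split m; first by rewrite /m; lia.
case: (boolP (odd n)) => on; last first.
  have en : n = m + m by rewrite /m; lia.
  apply: (@dec_pw_reindex ('I_(m + m) + 'I_(m + m))%type).
    by rewrite card_sum !card_ord cI -en.
  apply: dec_pw_sum; have := dec_pairs hs1 hs1 (cT m) (cT m).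
  have mm0 : 0 < m + m by rewrite addn_gt0 m0.
  rewrite sz1 -expnD => /(_ mm0 mm0 erefl) d.
  have -> : 2 ^ (n + n) = 2 ^ (m + m + (m + m)) by rewrite -en.
  rewrite [X in decomposes _ X _]en.
  apply: dec_sub d => -[x y] [x' y'] [[/= /cov1 h ->]|[/= -> /cov1 h]]; by [left|right].
have [|cs2 [sz2 hs2 cov2]] := split m.+1; first by rewrite /m; lia.
have en : n = m + m.+1 by rewrite /m; lia.
apply: (@dec_pw_reindex ('I_(m.+1 + m.+1) + 'I_(m + m))%type).
  by rewrite card_sum !card_ord cI; lia.
apply: dec_pw_sum.
have nbs x := @ham_cube_neighbours _ cs2 x _ hs2 cov2.
case: cs2 sz2 hs2 cov2 nbs => [|a [|b cs2]] //=; first by case=> m'; rewrite -m' in m0.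
case=> sz2 /and3P[ha hb hs2] cov2 nbs.
case: cs1 sz1 hs1 cov1 => [sz1|c cs1 /= sz1 /andP[hc hs1] cov1]; first by rewrite -sz1 in m0.
have {}nbs x : let nb := [:: next a x, next b x & [seq next c x | c <- cs2]] ++
    [:: prev a x, prev b x & [seq prev c x | c <- cs2]] in
    uniq nb /\ forall y, y \in nb -> exists i, y = flip x i.
  by apply: nbs; rewrite card_ord sz2.
have col_a x : colour (next a x) = ~~ colour x.
  have [_ h] := nbs x; have [|i ->] := h (next a x); last exact: colour_flip.
  by rewrite inE eqxx.
have col_b x : colour (next b x) = ~~ colour x.
  have [_ h] := nbs x; have [|i ->] := h (next b x); last exact: colour_flip.
  by rewrite !inE eqxx orbT.
pose u : {ffun 'I_(m.+1 + m.+1) -> bool} := [ffun=> false].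
have [] := nbs u; rewrite cat_uniq => /and3P[_ /hasPn disj /andP[uprev _]] _.
have nab : next a u != prev b u.
  have := disj (prev b u); rewrite !inE eqxx orbT => /(_ isT).
  by rewrite eq_sym negb_or => /andP[].
have pab : next a (prev b u) != u.
  apply: contra uprev => /eqP e; rewrite inE -[u in prev a u]e prev_next ?eqxx //.
  exact: ham_uniq.
have d3 := dec_triple ha hb hc (cT m.+1) (cT m) _ col_a col_b
  (next_prev (ham_uniq hb) u) nab pab.
have dp := dec_pairs hs2 hs1 (cT m.+1) (cT m).
rewrite -expnD in d3 dp.
have q2 : 1 < m + m <= m.+1 + m.+1 by clear -m0; lia.
have szd : size cs2 = size cs1 by apply: succn_inj; rewrite sz1 sz2.
have pos : 0 < m.+1 + m.+1 /\ 0 < m + m by clear -m0; lia.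
have N2 : 2 ^ (m.+1 + m.+1 + (m + m)) = 2 ^ (n + n) by congr (2 ^ _); clear -en; lia.
rewrite N2 in d3 dp.
have n3 : n = 3 + (size cs2 + size cs1) by clear -en sz1 sz2; lia.
rewrite [X in decomposes _ X]n3.
apply: dec_sub (dec_union (dec_sym (d3 q2)) (dp pos.1 pos.2 szd)).
move=> [x y] [x' y'] [[/= /cov2 h ->]|[/= -> /cov1 h]].
  case: h => z; rewrite !inE => /or3P[/eqP ->|/eqP ->|zin] h.
  - by left; case: h => h; [left|right]; left; split=> //; left.
  - by left; case: h => h; [left|right]; left; split=> //; right.
  - by right; left; split=> //; exists z.
case: h => z; rewrite inE => /predU1P[->|zin] h.
  by left; case: h => h; [left|right]; right.
by right; right; split=> //; exists z.
Qed.

(** * Cycles of the cube *)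

(** Exponents at least 2n - 1 come from the n tori; smaller ones are
    already reached in both halves of the coordinates. *)
Lemma cube_dec a k : loss a k -> 2 < a ->
  forall n b (I : finType), 0 < n -> #|I| = a * (n + n) ->
    0 < b <= a * (n + n) - k -> decomposes (gpower (I := I) flip_step) (n * a) (2 ^ b * a).
Proof.
move=> la a2; have ka := loss_lt la.
elim/ltn_ind=> n IH b I n0 cI /andP[b0 ub].
case: (leqP (n + n).-1 b) => hb.
  apply: (@dec_pw_reindex ('I_a * 'I_(n + n))%type).
    by rewrite card_prod !card_ord cI.
  apply: dec_pw_curry; apply: (dec_class_split (N := 2 ^ (n + n))).
  - exact: [ffun=> false].
  - by rewrite card_ffun card_bool card_ord.
  - by apply: cube_hamiltonian; rewrite // card_ord.
  apply: (torus_dec_odd la) => //; rewrite ?card_ord ?hb //; lia.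
pose m := n./2; have n2 : 1 < n by lia.
have m0 : 0 < m by rewrite /m; lia.
have mn : m < n by rewrite /m; lia.
have nm : n <= m.*2.+1 by rewrite /m; lia.
have ubm : b <= a * (m + m) - k.
  have : a * 2 + 2 * (m + m).-2 <= a * (m + m) by nia.
  by lia.
apply: (@dec_pw_reindex ('I_(a * (m + m)) + 'I_(a * ((n - m) + (n - m))))%type).
  by rewrite card_sum !card_ord cI -mulnDr; congr (_ * _); lia.
have -> : n * a = m * a + (n - m) * a by rewrite -mulnDl subnKC // ltnW.
apply: dec_pw_sum; apply: dec_cart; apply: IH; rewrite ?card_ord ?b0 //; try lia.
Qed.

(** Removing the last digit and shifting by j, the least of the other exponents,
    lowers each of the remaining exponents by j, at a cost of j + 1. *)
Lemma binary_loss d (i : nat -> nat) :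
  0 < d -> (forall k, 1 <= k < d -> i k.+1 < i k) -> i d = 0 ->
  exists2 k, loss (\sum_(1 <= k < d.+1) 2 ^ i k) k
           & k <= d - 1 + \sum_(1 <= k < d.+1) i k.
Proof.
elim: d i => // -[|d] IH i _ decr last0.
  by exists 0; rewrite // big_nat1 last0; apply: loss1.
pose j := i d.+1.
have j0 : 0 < j by have := decr d.+1; rewrite last0; apply; rewrite /= ltnSn.
have lej k : 0 < k < d.+2 -> j <= i k.
  case/andP=> k0 kd; have -> : k = d.+1 - (d.+1 - k) by lia.
  have : d.+1 - k <= d by lia.
  elim: (d.+1 - k) => [|t IHt] ht; first by rewrite subn0.
  apply: leq_trans (IHt (ltnW ht)) _; apply: ltnW.
  have -> : d.+1 - t = (d.+1 - t.+1).+1 by lia.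
  by apply: decr; lia.
have [||k lk uk] := IH (fun k => i k - j) isT.
- move=> k hk; have := decr k; have := @lej k; have := @lej k.+1; lia.
- by rewrite subnn.
exists (k + j).+1.
  rewrite big_nat_recr //= last0 expn0 addn1.
  rewrite (eq_big_nat _ _ (F2 := fun k => 2 ^ j * 2 ^ (i k - j))).
    by rewrite -big_distrr; apply: loss_step.
  by move=> k' hk'; rewrite -expnD subnKC // lej.
rewrite big_nat_recr //= last0 addn0.
have -> : \sum_(1 <= k < d.+2) i k = \sum_(1 <= k < d.+2) (i k - j) + d.+1 * j.
  have -> : d.+1 * j = \sum_(1 <= k < d.+2) j by rewrite sum_nat_const_nat; lia.
  by rewrite -big_split; apply: eq_big_nat => k' hk'; rewrite /= subnK // lej.
by move: uk; nia.
Qed.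

Lemma hypercubeE m (x y : {ffun 'I_m -> bool}) :
  hypercube x y -> gpower flip_step x y.
Proof.
rewrite /hypercube => /cards1P[i /setP e]; exists i; split.
  by have := e i; rewrite !inE eqxx /flip_step; case: (x i); case: (y i).
by move=> j nj; have := e j; rewrite !inE (negbTE nj) => /negbFE/eqP.
Qed.

Lemma hypercube_flip m (x : {ffun 'I_m -> bool}) i : hypercube x (flip x i).
Proof.
rewrite /hypercube; apply/cards1P; exists i; apply/setP => j; rewrite !inE ffunE.
by case: (j == i); case: (x j).
Qed.

(** An edge is {x, flip x i} for at most two pairs (x, i), one for each end. *)
Lemma card_edges m : 2 ^ m * m <= #|edge_set (@hypercube m)| * 2.
Proof.
have -> : 2 ^ m * m = #|[set: {ffun 'I_m -> bool} * 'I_m]|.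
  by rewrite cardsT card_prod card_ffun card_bool !card_ord.
apply: (leq_card_fibers (g := fun z => [set z.1; flip z.1 z.2])).
  by move=> [x i] _; apply/imsetP; exists (x, flip x i); rewrite // inE hypercube_flip.
move=> C; case: (boolP [exists z : {ffun 'I_m -> bool} * 'I_m, C == [set z.1; flip z.1 z.2]]).
  case/existsP=> -[x i] /eqP eC; apply: leq_trans (_ : #|C| <= 2); last first.
    by rewrite eC cards2; case: (_ != _).
  rewrite -(card_in_imset (f := fun z => z.1)); last first.
    move=> [y k] [y' k']; rewrite !inE /= => /eqP e /eqP e' ey; congr (_, _) => //.
    move: e; rewrite -e' -ey => /setP /(_ (flip y k)); rewrite !inE eqxx orbT.
    case/esym/orP => [/eqP ek|/eqP /flip_inj //].
    by have := hypercube_flip y k; rewrite ek hypercube_irr.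
  apply: subset_leq_card; apply/subsetP => _ /imsetP[[y k] + ->].
  by rewrite !inE /= => /eqP <-; rewrite !inE eqxx.
rewrite negb_exists => /forallP h; rewrite (_ : [set _ in _ | _] = set0) ?cards0 //.
by apply/setP => z; rewrite !inE /= eq_sym (negbTE (h z)).
Qed.

(** There are as many positions as edges and all edges are covered, so each edge
    is covered exactly once: the orbits give a partition of the edges. *)
Lemma dec_family m r l : m = r + r -> 2 < l ->
  decomposes (gpower (I := 'I_m) flip_step) r l ->
  exists D : {set {set {set {ffun 'I_m -> bool}}}},
    [/\ cycle_decomposition (@hypercube m) D, #|D| * l = r * 2 ^ m
      & forall C, C \in D -> #|C| = l].
Proof.
move=> em l2 [X [s [loc [sK sloc fib cov]]]].
have l0 : 0 < l by lia.
pose edge x := [set loc x; loc (s x)].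
pose E := edge_set (@hypercube m).
have cX : #|X| = r * 2 ^ m.
  rewrite -cardsT (@card_fibers _ _ _ setT loc) // (eq_bigr (fun=> r)).
    by rewrite sum_nat_const cardsT card_ffun card_bool card_ord mulnC.
  by move=> v _; rewrite -(fib v); apply: eq_card => x; rewrite !inE.
have cE : #|X| <= #|E|.
  by have := card_edges m; rewrite cX -/E {2}em addnn -muln2 mulnA leq_pmul2r // mulnC.
have subE : E \subset [set edge x | x in X].
  apply/subsetP => C /imsetP[[u v]]; rewrite inE /= => /hypercubeE /cov [x h] ->.
  by apply/imsetP; exists x => //; rewrite /edge; case: h => -[-> ->] //; rewrite setUC.
have cI : #|[set edge x | x in X]| <= #|X| by apply: leq_imset_card.
have EE : E = [set edge x | x in X].
  by apply/eqP; rewrite eqEcard subE (leq_trans cI).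
have edge_inj : injective edge.
  have /imset_injP inj : #|[set edge x | x in X]| == #|X|.
    by rewrite eqn_leq cI -EE.
  by move=> x y; apply: inj.
have s_inj : injective s.
  by apply: (can_inj (g := iter l.-1 s)) => x; rewrite -iterSr prednK ?sK.
have csym := fconnect_sym s_inj.
have loc_orbit x y : fconnect s x y -> loc y = loc x -> y = x.
  move/iter_findex => <- /sloc /dvdnP[t ->].
  by elim: t => //= t IHt; rewrite mulSn iterD IHt sK.
have order_s x : order s x = l.
  apply/eqP; rewrite eqn_dvd (sloc x) ?iter_order // andbT.
  have := sK x; rewrite {1}(divn_eq l (order s x)) addnC iterD.
  have -> : iter (l %/ order s x * order s x) s x = x.
    elim: (_ %/ _) => //= t IHt; by rewrite mulSn iterD IHt iter_order.
  move=> h; apply: contraT; rewrite /dvdn -lt0n => lt0.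
  have lt : l %% order s x < order s x by rewrite ltn_mod order_gt0.
  by have := findex_iter lt; rewrite h findex0 => e; rewrite -e in lt0.
have iter_mod i x : iter (i %% l) s x = iter i s x.
  rewrite {2}(divn_eq i l) addnC iterD; congr iter.
  by elim: (i %/ l) => //= t IHt; rewrite mulSn iterD -IHt sK.
pose walk x := [seq loc y | y <- orbit s x].
have walk_uniq x : uniq (walk x).
  rewrite map_inj_in_uniq ?orbit_uniq // => y y'; rewrite -!fconnect_orbit => xy xy' e.
  by apply: loc_orbit e; rewrite (connect_trans _ xy) // csym.
have walk_size x : size (walk x) = l by rewrite size_map size_orbit order_s.
have walk_next x y : fconnect s x y -> next (walk x) (loc y) = loc (s y).
  move=> xy; have lt := findex_max xy; rewrite order_s in lt.
  have nth_walk i : i < l -> nth (loc x) (walk x) i = loc (iter i s x).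
    by move=> li; rewrite (nth_map x) ?size_orbit ?order_s // nth_traject ?order_s.
  rewrite -(iter_findex xy) -nth_walk // next_nth_mod ?walk_size //.
  by rewrite nth_walk ?ltn_mod // iter_mod.
pose orb x := [set edge y | y in fconnect s x].
have orbE x : orb x = edges_along (walk x).
  apply/setP => C; apply/imsetP/imsetP => [[y xy ->]|[v /mapP[y + ->] ->]].
    by exists (loc y); rewrite ?walk_next // map_f // -fconnect_orbit.
  by rewrite -fconnect_orbit => xy; exists y; rewrite ?walk_next.
have orb_card x : #|orb x| = l by rewrite card_imset // -(order_s x).
have orb_eq x y : fconnect s x y -> orb x = orb y.
  move=> xy; apply/setP => C; apply/imsetP/imsetP => -[z xz ->]; exists z => //.
    by rewrite inE -(same_connect csym xy).
  by rewrite inE (same_connect csym xy).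
pose D := [set orb x | x in X].
have D_card C : C \in D -> #|C| = l by case/imsetP=> x _ ->.
have part : partition D E.
  apply/and3P; split.
  - rewrite EE; apply/eqP/setP => C; apply/bigcupP/imsetP.
      by case=> _ /imsetP[x _ ->] /imsetP[y _ ->]; exists y.
    by case=> x _ ->; exists (orb x); apply: imset_f => //; apply: connect0.
  - apply/trivIsetP => _ _ /imsetP[x _ ->] /imsetP[y _ ->] nxy.
    rewrite -setI_eq0; apply: contraR nxy => /set0Pn[C].
    rewrite inE => /andP[/imsetP[z xz ->] /imsetP[z' yz' /edge_inj e]].
    by apply/eqP; rewrite (orb_eq _ _ xz) e -(orb_eq _ _ yz').
  - by apply/negP => /D_card; rewrite cards0 => e; rewrite -e in l0.
exists D; split=> //.
  split=> // C /imsetP[x _ ->]; exists (walk x); split=> //.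
  - by rewrite walk_size.
  - apply: cycle_from_next => // _ /mapP[y + ->].
    rewrite -fconnect_orbit => xy; rewrite walk_next //.
    have : edge y \in E by rewrite EE imset_f.
    case/imsetP=> -[u v]; rewrite inE /= => huv /setP e.
    have nuv : u != v by apply: contraTneq huv => ->; rewrite hypercube_irr.
    have := e u; have := e v; have := e (loc y); have := e (loc (s y)).
    rewrite !inE !eqxx /= !orbT.
    move=> /esym/orP[]/eqP -> /esym/orP[]/eqP ->; rewrite ?eqxx ?orbb /=.
    + by move=> /eqP e'; rewrite e' eqxx in nuv.
    + by rewrite hypercube_sym.
    + by [].
    + by rewrite (negbTE nuv).
by rewrite -(card_uniform_partition D_card part) -cX; apply/eqP; rewrite eqn_leq cE EE cI.
Qed.

Theorem mainTheorem5 (n a d : nat) (i : nat -> nat)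
    (hn : 1 <= n) (ha : 3 <= a) (ha_odd : odd a)
    (ha_bin : a = \sum_(1 <= k < d.+1) 2 ^ i k)
    (hi_decr : forall k, 1 <= k < d -> i k.+1 < i k)
    (hi_last : i d = 0)
    (alpha : nat)
    (halpha : 1 <= alpha <= 2 * a * n - (d - 1) - \sum_(1 <= k < d.+1) i k) :
  exists D : {set {set {set {ffun 'I_(2 * a * n) -> bool}}}},
    [/\ cycle_decomposition (@hypercube (2 * a * n)) D,
        #|D| = n * 2 ^ (2 * a * n - alpha)
      & forall C, C \in D -> #|C| = a * 2 ^ alpha].
Proof.
have d0 : 0 < d by case: d ha_bin {hi_decr hi_last halpha} => // e; rewrite e big_nil in ha.
have [k lossk lek] := binary_loss d0 hi_decr hi_last.
rewrite -ha_bin in lossk; case/andP: halpha => al0 al.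
have dim : 2 * a * n = a * (n + n) by lia.
have [] := @dec_family (2 * a * n) (n * a) (2 ^ alpha * a).
- by lia.
- by have := expn_gt0 2 alpha; nia.
- apply: (cube_dec lossk) => //; first by rewrite card_ord.
  by rewrite al0 -dim; lia.
move=> D [cycD cardD lenD]; exists D; split=> //; last by move=> C /lenD ->; apply: mulnC.
have al_le : alpha <= 2 * a * n by lia.
apply/eqP; rewrite -(eqn_pmul2r (_ : 0 < 2 ^ alpha * a)) ?muln_gt0 ?expn_gt0 //; last by lia.
by rewrite cardD -{1}(subnK al_le) expnD; apply/eqP; lia.
Qed.
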